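(* Let $G$ be a free group of finite rank $r\ge1$ with free generating set $\{s_1,\dots,s_r\}$, let $\mathtt{A}$ be a finite set, and let $Z\subset \mathtt{A}^G$ be a subshift of finite type. Let $\mu$ be a $G$-invariant Borel probability measure on $\mathtt{A}^G$ with $\mu(Z)=1$. Define $$f^Z_\mu(\mathtt{A}^G)=\inf_{\mathcal{O}\ni\mu}\ \limsup_{n\to\infty}\frac1n\log \mathbb{E}_{\sigma\sim u_n}\,|\Omega_Z(\sigma,\mathcal{O})|,$$ where the infimum is over weak* open neighborhoods $\mathcal{O}$ of $\mu$ in $\mathrm{Prob}(\mathtt{A}^G)$. Then $$f_\mu(\mathtt{A}^G)=f^Z_\mu(\mathtt{A}^G).$$
   Context: $G$ acts on $\mathtt{A}^G$ (product topology) by the left shift $(gx)(h)=x(g^{-1}h)$. **Subshifts of finite type.** A subshift is a closed $G$-invariant subset of $\mathtt{A}^G$. It has finite type if there is a finite collection $\mathcal{W}$ of maps $w:D_w\to \mathtt{A}$, with each $D_w\subset G$ finite, such that $Z$ is the set of all $x\in \mathtt{A}^G$ such that for all $g\in G$ and $w\in\mathcal{W}$ the restriction of $gx$ to $D_w$ is not equal to $w$. **The $f$-invariant.** For an observable (measurable map to a finite set) $\phi$ on $\mathtt{A}^G$, $\mathrm{H}_\mu(\phi)=-\sum_a\mu(\phi^{-1}(a))\log\mu(\phi^{-1}(a))$ is its Shannon entropy. For finite $H\subset G$, $\phi^H(x)=(\phi(h^{-1}x))_{h\in H}$. Set $F_\mu(\phi)=(1-2r)\mathrm{H}_\mu(\phi)+\sum_{i=1}^r\mathrm{H}_\mu(\phi^{\{e,s_i\}})$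 and $f_\mu(\phi)=\inf_{\rho}F_\mu(\phi^{\mathrm{B}(e,\rho)})$, where $\mathrm{B}(e,\rho)$ is the ball of radius $\rho$ about the identity $e$ in the word metric. $f_\mu(\mathtt{A}^G)$ denotes the $f$-invariant of the shift action on $(\mathtt{A}^G,\mu)$, i.e. $f_\mu(\phi)$ for the canonical generating observable $\phi(x)=x(e)$. A known theorem (L. Bowen) states that $f_\mu(\mathtt{A}^G)=\inf_{\mathcal{O}\ni\mu}\limsup_{n\to\infty}\frac1n\log\mathbb{E}_{\sigma\sim u_n}|\Omega(\sigma,\mathcal{O})|$, with the notation below. **Microstates.** Let $[n]=\{1,\dots,n\}$ and let $u_n$ be the uniform probability measure on the finite set $\mathrm{Hom}(G,\mathrm{sym}(n))$ of homomorphisms from $G$ to the symmetric group on $[n]$. For $\sigma\in\mathrm{Hom}(G,\mathrm{sym}(n))$, $\mathbf{x}\in \mathtt{A}^n$ (a map $[n]\to \mathtt{A}$) and $v\in[n]$, the pullback name $\mathbf{x}^\sigma_v\in \mathtt{A}^G$ is $\mathbf{x}^\sigma_v(g)=\mathbf{x}(\sigma(g)^{-1}v)$. The empirical distribution is $P^\sigma_{\mathbf{x}}=\frac1n\sum_{v\in[n]}\delta_{\mathbf{x}^\sigma_v}\in\mathrm{Prob}(\mathtt{A}^G)$, where $\mathrm{Prob}(\mathtt{A}^G)$ is the space of Borel probability measures with the weak* topology. For $\mathcal{O}\subset\mathrm{Prob}(\mathtt{A}^G)$ open, $\Omega(\sigma,\mathcal{O})=\{\mathbf{x}\in \mathtt{A}^n: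 P^\sigma_{\mathbf{x}}\in\mathcal{O}\}$ and $\Omega_Z(\sigma,\mathcal{O})=\{\mathbf{x}\in\Omega(\sigma,\mathcal{O}):P^\sigma_{\mathbf{x}}(Z)=1\}$ (equivalently $\mathbf{x}^\sigma_v\in Z$ for all $v\in[n]$). Convention: $\log 0=-\infty$. *)

(* Defs.v *)
From HB Require Import structures.
From mathcomp Require Import all_boot all_order all_algebra all_fingroup finmap.
From mathcomp Require Import all_classical all_reals all_analysis.

Set Implicit Arguments.
Unset Strict Implicit.
Unset Printing Implicit Defensive.

Import Order.TTheory GRing.Theory Num.Theory.
Import numFieldNormedType.Exports.

Local Open Scope classical_set_scope.
Local Open Scope ring_scope.

(* Measurable types are pointed in the library, so A ^ G can only carry a
   Borel structure when A is nonempty; this loses nothing, since A ^ G carries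
   no probability measure when A is empty.  The point is used nowhere else. *)
#[short(type="alphabetType")]
HB.structure Definition Alphabet := {A of Finite A & Pointed A}.

Definition borel (T : ptopologicalType) : measurableType _ :=
  g_sigma_algebraType (@open T).

Definition weakstar_eval (T : ptopologicalType) (R : realType)
    (mu : probability (borel T) R) : {ptws continuousType T R -> R} :=
  fun f => Rintegral mu setT f.

(* The coarsest topology making mu |-> \int f dmu continuous for every
   continuous f : T -> R.  This is the weak* topology when T is compact, which
   holds for T = A ^ G. *)
Definition Prob (T : ptopologicalType) (R : realType) : topologicalType :=
  initial_topology (@weakstar_eval T R).

Section free_groups.
Variables (G : groupType) (r : nat) (s : 'I_r -> G).

Definition free_basis : Prop :=
  forall (H : groupType) (t : 'I_r -> H),
    exists! f : G -> H,
      (forall x y, f (x * y)%g = (f x * f y)%g) /\ forall i, f (s i) = t i.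

Definition letter (l : 'I_r * bool) : G :=
  if l.2 then s l.1 else ((s l.1)^-1)%g.

(* This set is finite, so that fset_set returns the same set. *)
Definition ball (rho : nat) : {fset G} :=
  fset_set [set g : G | exists w : seq ('I_r * bool),
    (size w <= rho)%N /\ g = (\prod_(l <- w) letter l)%g].

End free_groups.

Definition fullshift (G : groupType) (A : alphabetType) : Type := G -> A.

HB.instance Definition _ (G : groupType) (A : alphabetType) :=
  Topological.copy (fullshift G A) {ptws G -> discrete_topology A}.
HB.instance Definition _ (G : groupType) (A : alphabetType) :=
  isPointed.Build (fullshift G A) (fun=> point).

Section shift_action.
Variables (G : groupType) (A : alphabetType).
Local Notation X := (fullshift G A).

Definition shift (g : G) (x : X) : X := fun h => x (g^-1 * h)%g.

Definition subshift (Z : set X) : Prop :=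
  closed Z /\ forall g x, Z x -> Z (shift g x).

(* A pattern w : D_w -> A with D_w a finite subset of G is an element of
   {fmap G -> A}, with D_w = domf w. *)
Definition finite_type (Z : set X) : Prop :=
  exists W : seq {fmap G -> A},
    Z = [set x | forall g w, w \in W ->
                   [fmap h : domf w => shift g x (val h) : A] <> w].

Definition shift_invariant (R : realType) (mu : probability (borel X) R) :=
  forall (g : G) (B : set (borel X)),
    measurable B -> mu (shift g @^-1` B) = mu B.

Definition coord1 (x : X) : A := x 1%g.

Definition translates (B : finType) (phi : X -> B) (H : {fset G}) (x : X) :
    {ffun H -> B} :=
  [ffun h => phi (shift (val h)^-1%g x)].

End shift_action.

Definition shannon (T : ptopologicalType) (R : realType)
    (mu : probability (borel T) R) (B : finType) (phi : T -> B) : R :=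
  - \sum_(b : B) (let p := fine (mu (phi @^-1` [set b])) in p * ln p).

Section f_invariant.
Variables (R : realType) (G : groupType) (r : nat) (s : 'I_r -> G).
Variables (A : alphabetType) (mu : probability (borel (fullshift G A)) R).

Definition F_functional (B : finType) (phi : fullshift G A -> B) : R :=
  (1 - 2 * r%:R) * shannon mu phi
  + \sum_(i < r) shannon mu (translates phi [fset 1%g; s i]%fset).

Definition f_observable (B : finType) (phi : fullshift G A -> B) : \bar R :=
  ereal_inf (range (fun rho : nat =>
    (F_functional (translates phi (ball s rho)))%:E)).

Definition f_invariant : \bar R := f_observable (@coord1 G A).

End f_invariant.

(* Products in {perm _} compose from left to right in the library, whereas
   sigma (g * h) means sigma g after sigma h here. *)
Definition Hom_sym (G : groupType) (n : nat) : set (G -> {perm 'I_n}) :=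
  [set sigma | forall g h v, sigma (g * h)%g v = sigma g (sigma h v)].

(* Meaningful for S finite and nonempty; Hom_sym G n is so when G is free of
   finite rank. *)
Definition uniform_expectation (R : realType) (I : choiceType) (S : set I)
    (f : I -> R) : R :=
  (\sum_(i \in S) f i) / #|` fset_set S|%:R.

Section microstates.
Variables (R : realType) (G : groupType) (A : alphabetType).
Local Notation X := (fullshift G A).

Definition pullback_name (n : nat) (sigma : G -> {perm 'I_n})
    (x : {ffun 'I_n -> A}) (v : 'I_n) : X :=
  fun g => x ((sigma g)^-1%g v).

Section empirical.
Variables (n : nat) (sigma : G -> {perm 'I_n.+1}) (x : {ffun 'I_n.+1 -> A}).

Definition empirical (B : set (borel X)) : \bar R :=
  ((n.+1%:R)^-1%:E * \sum_(v < n.+1) \d_(pullback_name sigma x v : borel X) B)%E.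

Let empiricalE : empirical =
  mscale ((n.+1%:R)^-1)%:nng
    (msum (fun k => dirac (pullback_name sigma x (inord k) : borel X)) n.+1).
Proof.
apply/funext => B; rewrite /empirical /mscale /= /msum.
by congr (_ * _)%E; apply: eq_bigr => v _; rewrite inord_val.
Qed.

Let empirical0 : empirical set0 = 0%E.
Proof. by rewrite empiricalE measure0. Qed.

Let empirical_ge0 B : (0 <= empirical B)%E.
Proof. by rewrite empiricalE. Qed.

Let empirical_sigma_additive : semi_sigma_additive empirical.
Proof. rewrite empiricalE; exact: measure_semi_sigma_additive. Qed.

HB.instance Definition _ := isMeasure.Build _ _ _ empirical
  empirical0 empirical_ge0 empirical_sigma_additive.

Let empirical_setT : empirical setT = 1%E.
Proof.
rewrite /empirical (eq_bigr (fun=> 1%E)); last by move=> v _; rewrite diracT.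
by rewrite sumEFin sumr_const card_ord -EFinM mulVf.
Qed.

HB.instance Definition _ :=
  Measure_isProbability.Build _ _ _ empirical empirical_setT.

Definition empirical_prob : Prob X R := empirical : probability (borel X) R.

End empirical.

Definition microstates (n : nat) (sigma : G -> {perm 'I_n.+1})
    (O : set (Prob X R)) : {set {ffun 'I_n.+1 -> A}} :=
  [set x | `[< O (empirical_prob sigma x) >]]%SET.

Definition microstates_in (Z : set X) (n : nat) (sigma : G -> {perm 'I_n.+1})
    (O : set (Prob X R)) : {set {ffun 'I_n.+1 -> A}} :=
  [set x in microstates sigma O | `[< empirical sigma x Z = 1%E >]]%SET.

(* Sequences are indexed from 0, so the n-th term is the one for [n + 1]. *)
Definition growth_rate_in (Z : set X) (O : set (Prob X R)) : \bar R :=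
  limn_esup (fun n =>
    (n.+1%:R^-1)%:E *
    lne (uniform_expectation (@Hom_sym G n.+1)
           (fun sigma => #|microstates_in Z sigma O|%:R))%:E)%E.

Definition f_invariant_in (Z : set X) (mu : Prob X R) : \bar R :=
  ereal_inf [set growth_rate_in Z O | O in [set O | open O /\ O mu]].

End microstates.

(* Main.v *)
Require Import Defs.
From HB Require Import structures.
From mathcomp Require Import all_boot all_order all_algebra all_fingroup finmap.
From mathcomp Require Import all_classical all_reals all_analysis.
From mathcomp Require Import ring lra zify.

(* Fix a ball B about the identity, let K be the set of patterns on B, and send
   a coloring x of a permutation action sigma to the K-coloring y listing the
   restrictions to B of its pullback names.  The number of pairs (sigma, y)
   whose joint types along the r generators are W_1, ..., W_r, with common
   marginal N, is exactly n! (prod N!)^(2r) / (prod N! prod_i prod W_i!), so by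
   Stirling its quotient by n!^r is exp (n F + O(log n)), where F is
   (1 - 2r) H(N/n) + sum_i H(W_i/n).
   Upper bound: (sigma, x) |-> (sigma, y) is injective, there are polynomially
   many types, and the entropies are continuous; hence f^Z <= F_mu(phi^B) for
   every B, whatever Z is.
   Lower bound: given O, weak* density of local functions provides a ball B such
   that closeness to mu on patterns over B forces membership in O.  Simultaneous
   Diophantine approximation yields infinitely many n for which rounding n mu
   gives integer joint types with exactly matching marginals and supported on
   patterns of positive mu-mass.  Every pair (sigma, y) with these types comes
   from a coloring x, because patterns of positive mass overlap consistently,
   and x is a microstate in Z, because such patterns occur in Z and B contains
   the forbidden windows. *)

Set Implicit Arguments.
Unset Strict Implicit.
Unset Printing Implicit Defensive.

Import Order.TTheory GRing.Theory Num.Theory.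
Import numFieldNormedType.Exports.

(** * Counting configurations by type *)

Section type_classes.
Variable K : finType.
Implicit Types N : K -> nat.

(** The multinomial formula, stated without division. Induction on n: deleting the first letter k
    turns the counts N into [N' k], and (N k)! = N k (N k - 1)!, so tuples starting with k
    contribute N k n!; these contributions add up to (n + 1) n!. *)
Lemma card_count_tuples n N : \sum_k N k = n ->
  #|[set s : n.-tuple K | [forall k, count_mem k s == N k]]%SET|
    * \prod_k (N k)`! = n`!.
Proof.
elim: n N => [|n IHn] N.
  move=> /eqP; rewrite sum_nat_eq0 => /forallP /= N0.
  rewrite big1 ?muln1; last by move=> k _; rewrite (eqP (N0 k)).
  rewrite (_ : [set _ | _]%SET = [set: _]%SET) ?cardsT ?card_tuple ?expn0//.
  apply/setP => s; rewrite !inE; apply/forallP => k.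
  by rewrite tuple0 /= eq_sym N0.
move=> sumN.
pose N' (k j : K) := N j - (j == k).
have E : #|[set s : n.+1.-tuple K | [forall k, count_mem k s == N k]]%SET|
  = \sum_(k | 0 < N k)
      #|[set s : n.-tuple K | [forall j, count_mem j s == N' k j]]%SET|.
  rewrite -sum1_card.
  pose h (p : K * n.-tuple K) : n.+1.-tuple K := [tuple of p.1 :: p.2].
  have hb : bijective h.
    exists (fun s => (thead s, [tuple of behead s])).
      by case=> k s; rewrite /h /= theadE; congr pair; apply: val_inj.
    by move=> s; rewrite /h /= -tuple_eta.
  rewrite (reindex h); last exact: onW_bij.
  rewrite big_mkcond [RHS]big_mkcond /=.
  pose f k (s : n.-tuple K) := if (cons_tuple k s) \in
    [set s : n.+1.-tuple K | [forall k, count_mem k s == N k]]%SET then 1 else 0.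
  rewrite (eq_bigr (fun p => f p.1 p.2)) // -(pair_bigA _ f) /= /f.
  apply: eq_bigr => k _; case: ifPn => [Nk|]; last first.
    rewrite -eqn0Ngt => /eqP Nk; apply: big1 => s _.
    rewrite inE; case: forallP => // /(_ k) /=.
    by rewrite Nk eqxx.
  rewrite -sum1_card [RHS]big_mkcond /=; apply: eq_bigr => s _; rewrite !inE.
  congr (if _ then _ else _); apply: eq_forallb => j /=; rewrite /N' [j == k]eq_sym.
  by case: (eqVneq k j) => [<-|_] /=; apply/eqP/eqP; lia.
rewrite E big_distrl /= factS -{1}sumN big_distrl /= big_mkcond /=.
apply: eq_bigr => k _; case: ifPn => [Nk|]; last first.
  by rewrite -eqn0Ngt => /eqP ->.
have N'k : N' k k = (N k).-1 by rewrite /N' eqxx subn1.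
have N'j j : j != k -> N' k j = N j by rewrite /N' => /negPf ->; rewrite subn0.
have /IHn <- : \sum_j N' k j = n.
  apply/eqP; rewrite -eqSS -sumN; apply/eqP.
  rewrite (bigD1 k) //= [RHS](bigD1 k) //= N'k -addSn prednK//.
  by congr addn; apply: eq_bigr => j; exact: N'j.
rewrite [RHS]mulnCA; congr muln.
rewrite (bigD1 k) //= [X in _ = _ * X](bigD1 k) //= N'k mulnA.
congr muln; first by rewrite -[in LHS](prednK Nk) factS prednK.
by apply: eq_bigr => j jk; rewrite N'j.
Qed.

Variable n : nat.
Implicit Types y z : {ffun 'I_n -> K}.

Definition occ y (k : K) : nat := #|[set v | y v == k]%SET|.

Lemma occ_count y k : occ y k = count_mem k [tuple y i | i < n].
Proof.
rewrite /occ cardsE cardE /enum_mem size_filter -enumT /= count_map.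
by apply: eq_count => i /=; rewrite unfold_in.
Qed.

Lemma card_occ N : \sum_k N k = n ->
  #|[set y | [forall k, occ y k == N k]]%SET| * \prod_k (N k)`! = n`!.
Proof.
move=> sumN; rewrite -(card_count_tuples sumN); congr muln.
pose h (s : n.-tuple K) : {ffun 'I_n -> K} := [ffun i => tnth s i].
have hK : cancel h (fun y => [tuple y i | i < n]).
  by move=> s; apply: eq_from_tnth => i; rewrite tnth_mktuple ffunE.
have hK' : cancel (fun y => [tuple y i | i < n]) h.
  by move=> y; apply/ffunP => i; rewrite ffunE tnth_mktuple.
rewrite -(card_imset _ (can_inj hK)); apply: eq_card => y.
rewrite !inE; apply/idP/imsetP => [/forallP yN|[s + ->]].
  exists [tuple y i | i < n]; rewrite ?hK' // inE; apply/forallP => k.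
  by rewrite -occ_count.
rewrite inE => /forallP sN; apply/forallP => k.
by rewrite occ_count hK.
Qed.

Lemma sum_occ y : \sum_k occ y k = n.
Proof.
rewrite -[RHS]card_ord -sum1_card (partition_big y xpredT) //=.
by apply: eq_bigr => k _; rewrite sum1_card /occ cardsE.
Qed.

Definition fperm y (t : {perm 'I_n}) : {ffun 'I_n -> K} := [ffun v => y (t v)].

Lemma occ_fperm y t k : occ (fperm y t) k = occ y k.
Proof.
rewrite /occ -[RHS](card_preimset _ (@perm_inj _ t)).
by apply: eq_card => v; rewrite !inE ffunE.
Qed.

Lemma occ_fpermP y z : (forall k, occ y k = occ z k) -> exists t, z = fperm y t.
Proof.
move=> yz.
have /tuple_permP [t tE] : perm_eq [tuple z i | i < n] [tuple y i | i < n].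
  by apply/allP => k _ /=; rewrite -!occ_count yz.
exists t; apply/ffunP => v; rewrite ffunE.
move/val_inj: tE => /(congr1 (fun s => tnth s v)).
by rewrite !tnth_mktuple.
Qed.

Lemma fpermM y s t : fperm (fperm y s) t = fperm y (t * s)%g.
Proof. by apply/ffunP => v; rewrite !ffunE permM. Qed.

(** The permutations carrying y to z form a coset of the stabilizer of y, because Sym(n) is
    transitive on the colorings with given counts. *)
Lemma card_fperm_transport y z : (forall k, occ y k = occ z k) ->
  #|[set t | fperm y t == z]%SET| = #|[set t | fperm y t == y]%SET|.
Proof.
move=> /occ_fpermP[t0 ->].
rewrite -[RHS](card_imset _ (mulgI t0)); apply: eq_card => t.
rewrite inE; apply/eqP/imsetP => [tE|[u + ->]].
  exists (t0^-1 * t)%g; last by rewrite mulKVg.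
  rewrite inE -fpermM tE fpermM mulVg.
  by apply/eqP/ffunP => v; rewrite ffunE perm1.
by rewrite inE -fpermM => /eqP ->.
Qed.

(** Orbit-stabilizer: the map t |-> [fperm y t] splits the n! permutations into fibers of equal size
    over the n! / prod (occ y k)! colorings with the counts of y. *)
Lemma card_fperm_eq y z : (forall k, occ y k = occ z k) ->
  #|[set t | fperm y t == z]%SET| = \prod_k (occ y k)`!.
Proof.
move=> yz; rewrite card_fperm_transport //.
have pos : 0 < #|[set z | [forall k, occ z k == occ y k]]%SET|.
  by apply/card_gt0P; exists y; rewrite inE; apply/forallP.
apply/eqP; rewrite -(eqn_pmul2l pos) card_occ ?sum_occ //.
apply/eqP; rewrite -[X in _ = X`!](card_ord n) -[in RHS]cardsT -card_perm -[RHS]sum1_card.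
rewrite [RHS](partition_big (fperm y)
  (fun z => [forall k, occ z k == occ y k])) /=; last first.
  by move=> t _; apply/forallP => k; rewrite occ_fperm.
rewrite -sum_nat_const [LHS]big_mkcond [RHS]big_mkcond /=.
apply: eq_bigr => x _; rewrite inE; case: ifP => // /forallP xy.
rewrite sum1_card -(card_fperm_transport (z := x)); last by move=> k; rewrite (eqP (xy k)).
apply: eq_card => t; rewrite inE [RHS]unfold_in /= -[LHS]andTb; congr andb.
suff -> : t \in perm_on [set: _]%SET by [].
by apply/fintype.subsetP => v _; rewrite !inE.
Qed.

End type_classes.

(** * Pairs of colorings with a prescribed joint type *)

Section joint_types.
Variables (K : finType) (n : nat).
Implicit Types (y z : {ffun 'I_n -> K}) (W : K * K -> nat).

Definition joint y z : {ffun 'I_n -> K * K} := [ffun v => (y v, z v)].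

Lemma fperm_joint y z t : fperm (joint y z) t = joint (fperm y t) (fperm z t).
Proof. by apply/ffunP => v; rewrite !ffunE. Qed.

Lemma occ_joint_l y z k : \sum_l occ (joint y z) (k, l) = occ y k.
Proof.
rewrite /occ -[RHS]sum1_card (partition_big z xpredT) //=.
apply: eq_bigr => l _; rewrite sum1_card.
by apply: eq_card => v; rewrite !inE unfold_in /= ffunE xpair_eqE inE.
Qed.

Lemma occ_joint_r y z l : \sum_k occ (joint y z) (k, l) = occ z l.
Proof.
rewrite /occ -[RHS]sum1_card (partition_big y xpredT) //=.
apply: eq_bigr => k _; rewrite sum1_card.
by apply: eq_card => v; rewrite !inE unfold_in /= ffunE xpair_eqE inE andbC.
Qed.

(** Double counting. The number of z depends only on the counts of y, since a permutation carrying y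
    to x carries the partners of y to those of x. Summed over the type class [Y] of y, it counts all
    colorings by pairs with counts W, whose number is multinomial. *)
Lemma card_joint y W :
    (forall k, \sum_l W (k, l) = occ y k) ->
  #|[set z | [forall p, occ (joint y z) p == W p]]%SET| * \prod_p (W p)`!
    = \prod_k (occ y k)`!.
Proof.
move=> Wl.
have sumW : \sum_p W p = n.
  rewrite (eq_bigr (fun p => W (p.1, p.2))); last by case.
  rewrite -(pair_bigA _ (fun k l => W (k, l))) /= -[RHS](sum_occ y).
  exact: eq_bigr.
pose Y := [set x : {ffun 'I_n -> K} | [forall k, occ x k == occ y k]]%SET.
have pos : 0 < #|Y| by apply/card_gt0P; exists y; rewrite inE; apply/forallP.
apply/eqP; rewrite -(eqn_pmul2l pos); apply/eqP.
rewrite card_occ ?sum_occ // -(card_occ sumW) mulnA; congr muln.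
rewrite -sum_nat_const; transitivity (\sum_(x in Y)
    #|[set z | [forall p, occ (joint x z) p == W p]]%SET|).
  apply: eq_bigr => x; rewrite inE => /forallP xy.
  have [k|t ->] := @occ_fpermP _ _ y x; first by rewrite (eqP (xy k)).
  have fK : cancel (fun z => fperm z t) (fun z => fperm z t^-1%g).
    by move=> z; rewrite fpermM mulVg; apply/ffunP => v; rewrite ffunE perm1.
  have fK' : cancel (fun z => fperm z t^-1%g) (fun z => fperm z t).
    by move=> z; rewrite fpermM mulgV; apply/ffunP => v; rewrite ffunE perm1.
  rewrite -[LHS](card_imset _ (can_inj fK)); apply: eq_card => z.
  rewrite [RHS]inE; apply/imsetP/forallP => [[z' + ->]|zW].
    by rewrite inE => /forallP + p => /(_ p); rewrite -fperm_joint occ_fperm.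
  exists (fperm z t^-1%g); last by rewrite fK'.
  rewrite inE; apply/forallP => p.
  by rewrite -(occ_fperm _ t) fperm_joint fK'.
rewrite -[RHS]sum1_card.
rewrite (partition_big (fun u : {ffun 'I_n -> K * K} => [ffun v => (u v).1])
  (mem Y)) /=; last first.
  move=> u; rewrite !inE => /forallP uW; apply/forallP => k.
  rewrite -Wl -(occ_joint_l _ [ffun v => (u v).2]); apply/eqP.
  apply: eq_bigr => l _; rewrite -(eqP (uW (k, l))); congr (occ _ _).
  by apply/ffunP => v; rewrite !ffunE -surjective_pairing.
apply: eq_bigr => x _; rewrite sum1_card.
have ji : injective (joint x).
  move=> z z' /ffunP zz'; apply/ffunP => v.
  by have := zz' v; rewrite !ffunE => -[].
rewrite -[LHS](card_imset _ ji); apply: eq_card => u.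
rewrite [RHS]unfold_in /= inE; apply/imsetP/andP => [[z + ->]|[uW /eqP ux]].
  rewrite inE => zW; split=> //.
  by apply/eqP/ffunP => v; rewrite !ffunE.
exists [ffun v => (u v).2].
  rewrite inE; apply/forallP => p; rewrite -(eqP (forallP uW p)).
  apply/eqP; congr (occ _ _); rewrite -ux; apply/ffunP => v.
  by rewrite !ffunE -surjective_pairing.
by rewrite -ux; apply/ffunP => v; rewrite !ffunE -surjective_pairing.
Qed.

(** With N the counts of y, first z = [fperm y t] is chosen in prod N! / prod W! ways, then t among
    the prod N! permutations carrying y to z. The second marginal condition gives z the counts of
    y. *)
Lemma card_joint_fperm y W :
    (forall k, \sum_l W (k, l) = occ y k) ->
    (forall l, \sum_k W (k, l) = occ y l) ->
  #|[set t | [forall p, occ (joint y (fperm y t)) p == W p]]%SET|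
    * \prod_p (W p)`! = (\prod_k (occ y k)`!) ^ 2.
Proof.
move=> Wl Wr; rewrite -mulnn -{1}(card_joint Wl) mulnAC; congr muln.
rewrite -sum1_card.
rewrite (partition_big (fperm y)
  (mem [set z | [forall p, occ (joint y z) p == W p]]%SET)) /=; last first.
  by move=> t; rewrite !inE.
rewrite -sum_nat_const; apply: eq_bigr => z; rewrite inE => zW.
rewrite sum1_card -(@card_fperm_eq _ _ y z) => [|l]; last first.
  rewrite -Wr -(occ_joint_r y z); apply: eq_bigr => k _.
  by rewrite (eqP (forallP zW (k, l))).
apply: eq_card => t; rewrite !inE unfold_in /= inE andbC.
by case: eqVneq => // ->; rewrite zW.
Qed.

End joint_types.

Section configurations.
Variables (K : finType) (n r : nat).

Definition configurations (N : K -> nat) (W : 'I_r -> K * K -> nat) :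
    {set {ffun 'I_r -> {perm 'I_n}} * {ffun 'I_n -> K}} :=
  [set c : {ffun 'I_r -> {perm 'I_n}} * {ffun 'I_n -> K} |
    [forall k, occ c.2 k == N k] &&
    [forall i, [forall p, occ (joint c.2 (fperm c.2 (c.1 i))) p == W i p]]]%SET.

(** There are n! / prod N! choices of y; once y is fixed, the r permutations are chosen
    independently, the i-th one in (prod N!)^2 / prod W_i! ways. *)
Lemma card_configurations N W :
    \sum_k N k = n ->
    (forall i k, \sum_l W i (k, l) = N k) ->
    (forall i l, \sum_k W i (k, l) = N l) ->
  #|configurations N W| * (\prod_k (N k)`!) * \prod_i \prod_p (W i p)`!
    = n`! * (\prod_k (N k)`!) ^ (2 * r).
Proof.
move=> sumN Wl Wr; rewrite -(card_occ sumN) -[RHS]mulnAC -[LHS]mulnAC; congr muln.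
rewrite -sum1_card.
rewrite (partition_big snd
  (mem [set y : {ffun 'I_n -> K} | [forall k, occ y k == N k]]%SET)) /=; last first.
  by move=> c; rewrite !inE => /andP[].
rewrite big_distrl /= -sum_nat_const; apply: eq_bigr => y; rewrite inE => /forallP yN.
have yE k : occ y k = N k by apply/eqP.
have -> : (\prod_k (N k)`!) ^ (2 * r) = \prod_(i < r) (\prod_k (occ y k)`!) ^ 2.
  rewrite prod_nat_const card_ord expnM; congr ((_ ^ _) ^ _).
  by apply: eq_bigr => k _; rewrite yE.
pose F i := [pred t | [forall p, occ (joint y (fperm y t)) p == W i p]].
transitivity (#|family F| * \prod_i \prod_p (W i p)`!).
  congr muln; rewrite sum1_card.
  have pi : injective (fun t : {ffun 'I_r -> {perm 'I_n}} => (t, y)).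
    by move=> t t' [].
  rewrite -[RHS](card_imset _ pi); apply: eq_card => -[t z].
  rewrite unfold_in /= !inE /=.
  apply/andP/imsetP => [[/andP[_ tW] /eqP zy]|[t' t'F [-> ->]]].
    exists t; rewrite ?zy //; apply/familyP => i; rewrite inE.
    by move/forallP: tW => /(_ i); rewrite zy.
  split=> //; apply/andP; split; first exact/forallP.
  by apply/forallP => i; move/familyP: t'F => /(_ i); rewrite inE.
rewrite card_family foldrE big_map big_enum /= -big_split /=.
apply: eq_bigr => i _; rewrite -(@card_joint_fperm _ _ y (W i)) => [|k|l]; rewrite ?yE//.
by congr muln; apply: eq_card => t; rewrite !inE.
Qed.

End configurations.

(** * Words, balls and homomorphisms to symmetric groups *)

Section word_subgroup.
Local Open Scope group_scope.
Local Open Scope classical_set_scope.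
Variables (G : groupType) (r : nat) (s : 'I_r -> G).

Definition word (w : seq ('I_r * bool)) : G := \prod_(l <- w) letter s l.

Lemma word_cat w1 w2 : word (w1 ++ w2) = word w1 * word w2.
Proof. by rewrite /word big_cat. Qed.

Lemma word_cons l w : word (l :: w) = letter s l * word w.
Proof. by rewrite /word big_cons. Qed.

Definition winv (w : seq ('I_r * bool)) := rev [seq (l.1, ~~ l.2) | l <- w].

Lemma word_winv w : word (winv w) = (word w)^-1.
Proof.
elim: w => [|[i b] w IHw]; first by rewrite /word !big_nil invg1.
rewrite word_cons invgM -IHw /winv /= rev_cons -cats1 word_cat; congr (_ * _).
by rewrite word_cons /word big_nil mulg1 /letter; case: b => //=; rewrite invgK.
Qed.

Definition is_word : pred G := fun g => `[< exists w, g = word w >].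

Lemma is_word_group_closed : group_closed is_word.
Proof.
split; first by apply/asboolP; exists [::]; rewrite /word big_nil.
move=> _ _ /asboolP[w1 ->] /asboolP[w2 ->]; apply/asboolP.
by exists (w1 ++ winv w2); rewrite word_cat word_winv.
Qed.

(** Packaged as a [groupType] so that it can be a target of the universal property in
    [free_basis]. *)
Definition word_subgroup : Type := {g : G | is_word g}.
HB.instance Definition _ := SubChoice.on word_subgroup.
HB.instance Definition _ :=
  SubChoice_isSubGroup.Build G is_word word_subgroup is_word_group_closed.

(* The two endomorphisms of G given by the identity and by the retraction onto
   the subgroup of words agree on the basis, hence are equal. *)
Lemma free_basis_word : free_basis s -> forall g, exists w, g = word w.
Proof.
move=> fs g.
have sw i : is_word (s i).
  by apply/asboolP; exists [:: (i, true)]; rewrite /word big_seq1.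
have [f [[fM fs'] _]] := fs word_subgroup (fun i => Sub (s i) (sw i)).
have [h [_ huniq]] := fs G s.
have h1 : h = id by apply: huniq.
have h2 : h = fun g => val (f g).
  apply: huniq; split=> [x y|i]; first by rewrite fM valM.
  by rewrite fs' SubK.
suff -> : g = val (f g) by have /asboolP := valP (f g).
by rewrite -[LHS]/(id g) -h1 h2.
Qed.

Lemma finite_words rho : finite_set
  [set g : G | exists w : seq ('I_r * bool), (size w <= rho)%N /\ g = word w].
Proof.
elim: rho => [|n IHn].
  apply: (sub_finite_set (B := [set 1])) => // g [w []].
  by rewrite leqn0 => /nilP -> ->; rewrite /word big_nil.
pose S := [set g : G | exists w : seq ('I_r * bool), (size w <= n)%N /\ g = word w].
apply: (sub_finite_set (B := [set 1] `|`
  (fun p => letter s p.1 * p.2) @` ([set: 'I_r * bool] `*` S))).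
  move=> _ [[|l w] [wn ->]]; first by left; rewrite /word big_nil.
  by right; exists (l, word w); [split=> //; exists w|rewrite word_cons].
rewrite finite_setU; split => //; apply: finite_image.
by apply: finite_setX => //; exact: finite_finset.
Qed.

Lemma in_ball rho g :
  (g \in Defs.ball s rho) <-> exists w, (size w <= rho)%N /\ g = word w.
Proof.
rewrite /Defs.ball in_fset_set; last exact: finite_words.
by split=> [/set_mem|H] //; apply/mem_set.
Qed.

Lemma one_in_ball rho : 1 \in Defs.ball s rho.
Proof. by apply/in_ball; exists [::]; rewrite /word big_nil. Qed.

Lemma ball_le m n g : (m <= n)%N -> g \in Defs.ball s m -> g \in Defs.ball s n.
Proof.
by move=> mn /in_ball[w [wm ->]]; apply/in_ball; exists w; rewrite (leq_trans wm).
Qed.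

Lemma free_basis_ball (D : {fset G}) : free_basis s ->
  exists rho, forall g, g \in D -> g \in Defs.ball s rho.
Proof.
move=> /free_basis_word gen; elim/fset1U_rect: D => [|x D _ [rho IH]].
  by exists 0%N => g; rewrite inE.
have [w xw] := gen x; exists (maxn rho (size w)) => g; rewrite !inE => /orP[/eqP ->|gD].
  by apply/in_ball; exists w; rewrite leq_maxr.
by apply: ball_le (IH g gD); rewrite leq_maxl.
Qed.

End word_subgroup.

(** * Homomorphisms to Sym(n) as tuples of permutations *)

Section homs.
Local Open Scope group_scope.
Local Open Scope classical_set_scope.
Variables (G : groupType) (r : nat) (s : 'I_r -> G) (n : nat).
Hypothesis fs : free_basis s.

Lemma perm_hom_exists : exists h : {ffun 'I_r -> {perm 'I_n}} -> G -> {perm 'I_n},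
  forall t, (forall x y, h t (x * y) = h t x * h t y) /\ forall i, h t (s i) = t i.
Proof.
have /choice[h hP] : forall t : {ffun 'I_r -> {perm 'I_n}}, exists f : G -> {perm 'I_n},
    (forall x y, f (x * y) = f x * f y) /\ forall i, f (s i) = t i.
  by move=> t; have [f [Hf _]] := fs t; exists f.
by exists h.
Qed.

Definition perm_hom := sval (cid perm_hom_exists).

Lemma perm_homM t x y : perm_hom t (x * y) = perm_hom t x * perm_hom t y.
Proof. by rewrite /perm_hom; case: cid => h /= /(_ t)[]. Qed.

Lemma perm_homE t i : perm_hom t (s i) = t i.
Proof. by rewrite /perm_hom; case: cid => h /= /(_ t)[]. Qed.

Lemma perm_hom1 t : perm_hom t 1 = 1.
Proof. by apply: (mulgI (perm_hom t 1)); rewrite -perm_homM !mulg1. Qed.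

Lemma perm_homV t x : perm_hom t x^-1 = (perm_hom t x)^-1.
Proof. by apply: (mulgI (perm_hom t x)); rewrite -perm_homM !mulgV perm_hom1. Qed.

(* The inverse turns morphisms for the left-to-right product of {perm _} into
   morphisms for composition. *)
Definition sym_hom t (g : G) : {perm 'I_n} := (perm_hom t g)^-1.

(** If sigma is a morphism for composition, then g |-> sigma(g)^-1 is one for the product of
    [{perm _}], so uniqueness in [free_basis] identifies it with the [perm_hom] having the same
    values on the basis. *)
Lemma Hom_symE : @Hom_sym G n = range sym_hom.
Proof.
apply/seteqP; split=> [sigma Hs|_ [t _ <-] g h v] /=; last first.
  by rewrite /sym_hom perm_homM invMg permM.
pose t : {ffun 'I_r -> {perm 'I_n}} := [ffun i => (sigma (s i))^-1]; exists t => //.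
have [f [_ funiq]] := fs t.
have -> : sigma = fun g => (f g)^-1.
  rewrite (funiq (fun g => (sigma g)^-1)); last split=> [x y|i].
  - by apply/funext => g; rewrite invgK.
  - by rewrite -invMg; congr (_^-1); apply/permP => v; rewrite permM Hs.
  - by rewrite ffunE.
apply/funext => g; congr (_^-1); rewrite (funiq (perm_hom t))//.
by split; [exact: perm_homM|exact: perm_homE].
Qed.

Lemma sym_hom_inj : injective sym_hom.
Proof.
move=> t t' tt'; apply/ffunP => i; apply: invg_inj.
by have := congr1 (fun f => f (s i)) tt'; rewrite /sym_hom !perm_homE.
Qed.

Lemma uniform_expectation_sym_hom (R : realType) (f : (G -> {perm 'I_n}) -> R) :
  uniform_expectation (@Hom_sym G n) f
    = ((\sum_t f (sym_hom t)) / (n`! ^ r)%:R)%R.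
Proof.
rewrite /uniform_expectation Hom_symE.
(* Used twice: with values in R for the numerator, and with values in [nat] to count the
   homomorphisms, of which there are n!^r. *)
have sumE (V : nmodType) (F : (G -> {perm 'I_n}) -> V) :
    (\sum_(sigma \in range sym_hom) F sigma = \sum_t F (sym_hom t))%R.
  rewrite fsbig_image; last by move=> x y _ _; exact: sym_hom_inj.
  rewrite (fsbigE (enum {: {ffun 'I_r -> {perm 'I_n}}})) ?enum_uniq//; last first.
    by move=> t _; rewrite mem_enum.
  by rewrite big_enum_cond /=; apply: eq_bigl => t; rewrite in_setT.
congr (_ / _%:R)%R; first exact: sumE.
rewrite card_fset_sum1 -fsbig_finite; last by apply: finite_image; exact: finite_finset.
rewrite (sumE nat (fun=> 1%N)) sum_nat_const muln1 card_ffun card_ord; congr (_ ^ _)%N.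
rewrite -[RHS](congr1 factorial (card_ord n)) -[in RHS]cardsT -card_perm; apply: eq_card => t.
by rewrite inE; apply/esym/fintype.subsetP => v _; rewrite !inE.
Qed.

End homs.

Local Open Scope classical_set_scope.
Local Open Scope ring_scope.

(** * Entropy asymptotics *)

Section entropy_estimates.
Variable R : realType.
Implicit Types n m : nat.

Definition eta (x : R) : R := x * ln x.

Lemma eta0 : eta 0 = 0. Proof. by rewrite /eta mul0r. Qed.

(* No sign condition: ln is 0 on nonpositive reals. *)
Lemma eta_continuous : continuous eta.
Proof.
move=> x; have [x0|x0|->] := ltgtP x 0.
- rewrite /continuous_at [eta x](_ : _ = 0); last by rewrite /eta ln0 ?mulr0// ltW.
  apply: cvg_near_cst; near=> y; rewrite /eta ln0 ?mulr0 // ltW//.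
  by near: y; exact: lt_nbhsl.
- by apply: cvgM; [exact: cvg_id|exact: continuous_ln].
- rewrite /continuous_at eta0; apply/cvgr0Pnorm_lt => e e0; near=> y.
  have [y0|y0] := leP y 0; first by rewrite /eta ln0// mulr0 normr0.
  (* With y = z^2 and - ln z < 1/z, one gets |y ln y| = 2 z (z (- ln z)) < 2 z < e. *)
  pose z := Num.sqrt y; have z0 : 0 < z by rewrite sqrtr_gt0.
  have yE : y = z ^+ 2 by rewrite sqr_sqrtr ?ltW.
  have y1 : y < Num.min 1 ((e / 2) ^+ 2).
    by near: y; apply: lt_nbhsl; rewrite lt_min ltr01 exprn_gt0// divr_gt0.
  move: y1; rewrite lt_min => /andP[y1 ye].
  have z1 : z < e / 2.
    by rewrite -(@ltr_pXn2r _ 2) -?yE// ?nnegrE ?ltW// divr_gt0.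
  rewrite ler0_norm; last by rewrite mulr_ge0_le0 ?ltW// ln_lt0// y0.
  rewrite /eta yE lnXn// -mulrN mulr2n opprD.
  have : - ln z < z^-1 by rewrite -lnV ?posrE// ln_sublinear ?invr_gt0.
  move=> lz; have : z * - ln z < 1 by rewrite mulrC -ltr_pdivlMr// div1r.
  by rewrite expr2; nra.
Unshelve. all: by end_near.
Qed.

Lemma ln_ge1V (x : R) : 0 < x -> 1 - x^-1 <= ln x.
Proof.
move=> x0; rewrite -[ln x]opprK -lnV ?posrE// lerNr opprB.
have := @le_ln1Dx R (x^-1 - 1); rewrite [1 + _]addrC subrK; apply.
by rewrite ltrBrDr addNr invr_gt0.
Qed.

Lemma lnS_bounds n : (0 < n)%N ->
  n.+1%:R^-1 <= ln n.+1%:R - ln n%:R :> R /\ ln n.+1%:R - ln n%:R <= n%:R^-1 :> R.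
Proof.
move=> n0; have n0' : (0 : R) < n%:R by rewrite ltr0n.
rewrite -ln_div ?posrE//; split.
  apply: le_trans (ln_ge1V _); last by rewrite divr_gt0.
  rewrite invf_div -natr1 ; have : (0 : R) < n%:R + 1 by lra.
  by move=> ?; rewrite le_eqVlt; apply/orP; left; apply/eqP; field; lra.
have := @le_ln1Dx R n%:R^-1.
have -> : n.+1%:R / n%:R = 1 + n%:R^-1 :> R by rewrite -natr1; field; lra.
by apply; apply: (lt_trans (ltrN10 R)); rewrite invr_gt0.
Qed.

(** A crude error term in Stirling's formula; being logarithmic, it vanishes after division by n. *)
Definition stirling_err n : R := 1 + 2 * ln n.+1%:R.

Lemma stirling_err_ge0 n : 0 <= stirling_err n.
Proof. by rewrite addr_ge0// mulr_ge0// ln_ge0// ler1n. Qed.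

Lemma le_stirling_err m n : (m <= n)%N -> stirling_err m <= stirling_err n.
Proof.
by move=> mn; rewrite lerD2l ler_pM2l// ler_ln ?posrE// ler_nat.
Qed.

(** Induction on n. For n > 0, passing from n to n + 1 adds 1 - n (ln (n + 1) - ln n) to the
    difference, and this lies between 0 and 2 (ln (n + 2) - ln (n + 1)), the increment of
    [stirling_err]. *)
Lemma ln_fact_bounds n :
  `|ln n`!%:R - (eta n%:R - n%:R)| <= stirling_err n.
Proof.
suff [lo hi] : 0 <= ln n`!%:R - (eta n%:R - n%:R)
    /\ ln n`!%:R - (eta n%:R - n%:R) <= stirling_err n by rewrite ger0_norm.
elim: n => [|n [IHl IHr]].
  by rewrite fact0 ln1 eta0 !subr0 stirling_err_ge0.
have fE : ln n.+1`!%:R = ln n.+1%:R + ln n`!%:R :> R.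
  by rewrite factS natrM lnM ?posrE ?ltr0n ?fact_gt0.
rewrite fE; move: IHl IHr; rewrite /stirling_err /eta.
have [->|n0] := posnP n.
  by rewrite fact0 !ln1 mul0r !mulr0 !addr0 !subr0; move=> _ _; have := @ln_ge0 R 2%:R; lra.
have [l1 u1] := lnS_bounds n0; have [l2 _] := lnS_bounds (ltn0Sn n).
have n0' : (0 : R) < n%:R by rewrite ltr0n.
set a := ln n%:R in l1 u1 *; set b := ln n.+1%:R in l1 u1 l2 *.
set c := ln n.+2%:R in l2 *; set d := ln _.
have {}u1 : n%:R * (b - a) <= 1 by rewrite mulrC -ler_pdivlMr// mul1r.
have {l1 l2} : 1 <= n%:R * (b - a) + 2 * (c - b).
  apply: (@le_trans _ _ (n%:R * n.+1%:R^-1 + 2 * n.+2%:R^-1)).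
    rewrite -[n.+2%:R]natr1 -[n.+1%:R]natr1 -subr_ge0.
    have -> : n%:R * (n%:R + 1)^-1 + 2 * (n%:R + 1 + 1)^-1 - 1 =
       n%:R / ((n%:R + 1) * (n%:R + 1 + 1)) :> R by field; lra.
    by rewrite divr_ge0// ?mulr_ge0; lra.
  by apply: lerD; rewrite ler_pM2l//; lra.
rewrite -[n.+1%:R]natr1; move: n0' u1; set N : R := n%:R; clearbody a b c d N => *.
by split; nra.
Qed.

Lemma sum_eta_continuous (I : finType) (p : I -> R) (e : R) : 0 < e ->
  exists2 d, 0 < d & forall q : I -> R, (forall i, `|q i - p i| < d) ->
    `|\sum_i eta (q i) - \sum_i eta (p i)| <= e.
Proof.
(* The successor keeps the denominator positive when I is empty. *)
move=> e0; pose e' := e / #|I|.+1%:R.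
have e'0 : 0 < e' by rewrite divr_gt0.
have nd i : \forall d \near 0^'+, forall y, `|y - p i| < d -> `|eta y - eta (p i)| < e'.
  have /cvgrPdist_lt /(_ _ e'0) /nbhs_ballP [d /= d0 dE] := @eta_continuous (p i).
  near=> d' => y yd; rewrite distrC; apply: dE; rewrite /ball /= distrC.
  by apply: (lt_trans yd); near: d'; exact: nbhs_right_lt.
have [d [d0 dE]] : exists d, 0 < d /\ forall i y, `|y - p i| < d -> `|eta y - eta (p i)| < e'.
  have /filter_ex [d [d0 dE]] : \forall d \near 0^'+, 0 < d /\
      forall i y, `|y - p i| < d -> `|eta y - eta (p i)| < e'.
    near=> d; split => //; near: d; exact: filter_forall.
  by exists d.
exists d => // q qd; rewrite -sumrB; apply: (le_trans (ler_norm_sum _ _ _)).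
apply: (@le_trans _ _ (\sum_(i : I) e')).
  by apply: ler_sum => i _; apply/ltW/dE.
rewrite sumr_const -mulr_natr /e' mulrAC -mulrA ger_pMr//.
by rewrite ler_pdivrMr// mul1r ler_nat.
Unshelve. all: by end_near. Qed.

(** Stirling's formula is applied to each factorial, together with f ln f = n eta(f / n) + f ln n;
    the f i add up to n. *)
Lemma sum_ln_fact_bounds (I : finType) n (f : I -> nat) : (0 < n)%N ->
    (\sum_i f i)%N = n ->
  `|\sum_i ln (f i)`!%:R - (n%:R * (\sum_i eta ((f i)%:R / n%:R) + ln n%:R - 1))|
     <= #|I|%:R * stirling_err n.
Proof.
move=> n0 sumf; have n0' : (0 : R) < n%:R by rewrite ltr0n.
have -> : n%:R * (\sum_i eta ((f i)%:R / n%:R) + ln n%:R - 1)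
    = \sum_i (eta (f i)%:R - (f i)%:R).
  rewrite sumrB -natr_sum sumf mulrBr mulr1; congr (_ - _).
  rewrite mulrDr -[X in _ + X%:R * _]sumf natr_sum mulr_suml mulr_sumr -big_split /=.
  apply: eq_bigr => i _; rewrite /eta.
  have [->|fi] := posnP (f i); first by rewrite !mul0r mulr0 addr0.
  rewrite ln_div ?posrE ?ltr0n//; field; exact: lt0r_neq0.
rewrite -sumrB; apply: (le_trans (ler_norm_sum _ _ _)).
rewrite mulr_natl -sumr_const; apply: ler_sum => i _.
apply: (le_trans (ln_fact_bounds _)); apply: le_stirling_err.
by rewrite -sumf (bigD1 i) //= leq_addr.
Qed.

Section configuration_entropy.
Variables (K : finType) (r : nat).

(** The functional F as a function of the one-point and joint probabilities, so that it can be
    evaluated both at a measure and at normalized integer types. *)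
Definition config_entropy (p : K -> R) (q : 'I_r -> K * K -> R) : R :=
  (1 - 2 * r%:R) * (- \sum_k eta (p k)) + \sum_i (- \sum_x eta (q i x)).

(** Bounds the number of factorials, with multiplicity, in the count of configurations divided by
    n!^r: those of n, of the N k and of the W i x. *)
Definition config_coef : R :=
  1 + r%:R + (1 + 2 * r%:R) * #|K|%:R + r%:R * #|{: K * K}|%:R.

Lemma config_coef_ge0 : 0 <= config_coef.
Proof. by rewrite !addr_ge0 ?mulr_ge0 ?addr_ge0 ?mulr_ge0. Qed.

Definition config_err n : R := config_coef * stirling_err n.

(** The logarithm of the exact count is expanded by Stirling's formula; the entropy terms assemble
    into [config_entropy], and each factorial costs one [stirling_err]. *)
Lemma ln_card_configurations n N (W : 'I_r -> K * K -> nat) : (0 < n)%N ->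
    (\sum_k N k)%N = n ->
    (forall i k, \sum_l W i (k, l) = N k)%N ->
    (forall i l, \sum_k W i (k, l) = N l)%N ->
  `|ln (#|configurations n N W|%:R / n`!%:R ^+ r)
    - n%:R * config_entropy (fun k => (N k)%:R / n%:R) (fun i x => (W i x)%:R / n%:R)|
    <= config_err n.
Proof.
move=> n0 sumN Wl Wr.
have sumW i : (\sum_x W i x)%N = n.
  rewrite (eq_bigr (fun p => W i (p.1, p.2))); last by case.
  rewrite -(pair_bigA _ (fun k l => W i (k, l))) /= -[RHS]sumN.
  exact: eq_bigr.
have ln_prodn (I : finType) (f : I -> nat) :
    0 < \prod_i (f i)`!%:R :> R /\ ln (\prod_i (f i)`!%:R) = \sum_i ln (f i)`!%:R :> R.
  elim/big_rec2: _ => [|i x y _ [x0 <-]]; first by rewrite ln1.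
  have fi0 : (0 : R) < (f i)`!%:R by rewrite ltr0n fact_gt0.
  by rewrite mulr_gt0// lnM.
have [PN0 lnPN] := ln_prodn K N.
have PW0 i := (ln_prodn _ (W i)).1.
have [PPW0 lnPPW] : 0 < \prod_i \prod_x (W i x)`!%:R :> R /\
    ln (\prod_i \prod_x (W i x)`!%:R) = \sum_i \sum_x ln (W i x)`!%:R :> R.
  elim/big_rec2: _ => [|i x y _ [x0 <-]]; first by rewrite ln1.
  by rewrite mulr_gt0// lnM ?posrE// (ln_prodn _ _).2.
have := card_configurations sumN Wl Wr.
move=> /(congr1 (fun m => m%:R : R)); rewrite !natrM natrX !natr_prod.
under [X in _ * _ * X = _]eq_bigr do rewrite natr_prod.
set c := #|configurations n N W|.
have nf0 : (0 : R) < n`!%:R by rewrite ltr0n fact_gt0.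
move=> cE; have c0 : 0 < c%:R :> R.
  rewrite -(pmulr_lgt0 _ PN0) -(pmulr_lgt0 _ PPW0) cE.
  by rewrite mulr_gt0// exprn_gt0.
have {}cE := congr1 (@ln R) cE.
rewrite !lnM ?posrE ?mulr_gt0 ?exprn_gt0// !lnXn// lnPN lnPPW in cE.
rewrite ln_div ?posrE ?exprn_gt0// lnXn//.
have eN := sum_ln_fact_bounds n0 sumN.
have eW i := sum_ln_fact_bounds n0 (sumW i).
have := ln_fact_bounds n; rewrite /config_entropy /config_err /config_coef.
rewrite (_ : eta n%:R - n%:R = n%:R * (ln n%:R - 1)); last by rewrite /eta mulrBr mulr1.
move: eN eW cE; set HN := \sum_k eta _; set SN := \sum_k ln _.
pose HW i := \sum_x eta ((W i x)%:R / n%:R) : R.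
pose SW i := \sum_x ln (W i x)`!%:R : R.
rewrite -/(HW _) -[\sum_i \sum_x _]/(\sum_i SW i).
rewrite -[\sum_i - \sum_x _]/(\sum_i - HW i) => eN eW.
have {}eW i : `|SW i - n%:R * (HW i + ln n%:R - 1)|
    <= #|{: K * K}|%:R * stirling_err n by exact: eW.
move: SN HN SW HW (stirling_err n) (ln c%:R) (ln n`!%:R) (ln n%:R) eN eW.
move: #|K| #|{: K * K}| (n%:R : R) => a b x SN HN SW HW e Lc Lf L eN eW cE en.
set A : R := x * (L - 1) in en *.
(* The multiples of A = n (ln n - 1) cancel, because (1 - r) + (2 r - 1) - r = 0. *)
have -> : Lc - Lf *+ r - x * ((1 - 2 * r%:R) * - HN + \sum_i - HW i)
  = (1 - r%:R) * (Lf - A) + (2 * r%:R - 1) * (SN - x * (HN + L - 1))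
    - \sum_i (SW i - x * (HW i + L - 1)).
  have -> : Lc = Lf + SN * (2 * r%:R) - SN - \sum_i SW i.
    move: cE; rewrite -(mulr_natr SN) natrM; move: (\sum_i SW i) => t; lra.
  have -> : \sum_i (SW i - x * (HW i + L - 1)) = \sum_i SW i - x * \sum_i HW i - A * r%:R.
    rewrite mulr_sumr (mulr_natr A) -[X in A *+ X](card_ord r) -sumr_const -!sumrB /=.
    by apply: eq_bigr => i _; rewrite /A; ring.
  rewrite sumrN -(mulr_natr _ r) /A; move: (\sum_i SW i) (\sum_i HW i) => t u; ring.
have r0 : (0 : R) <= r%:R by [].
apply: (le_trans (ler_normB _ _)); apply: (@le_trans _ _
  ((1 + r%:R) * e + (1 + 2 * r%:R) * (a%:R * e) + \sum_(i < r) b%:R * e)); last first.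
  rewrite sumr_const card_ord -mulr_natl le_eqVlt; apply/orP; left; apply/eqP; ring.
apply: lerD; last first.
  by apply: (le_trans (ler_norm_sum _ _ _)); apply: ler_sum => i _; exact: eW.
apply: (le_trans (ler_normD _ _)); rewrite !normrM; apply: lerD.
  by apply: ler_pM => //; rewrite ler_norml; lra.
by apply: ler_pM => //; rewrite ler_norml; lra.
Qed.

End configuration_entropy.

End entropy_estimates.

(** * Rounding probabilities to exact integer types *)

Section rounding.
Variable R : realType.

(* Pigeonhole on the fractional parts of the multiples of the vector n0 p. *)
Lemma simultaneous_approximation (I : finType) (p : I -> R) (e : R) (n0 : nat) :
  0 < e -> (0 < n0)%N ->
  exists2 n, (n0 <= n)%N & exists m : I -> int, forall i, `|n%:R * p i - (m i)%:~R| < e.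
Proof.
move=> e0 n00; have [Q Q0 Qe] : exists2 Q : nat, (0 : R) < Q%:R & Q%:R^-1 < e.
  exists (Num.truncn e^-1).+1; rewrite ?ltr0n//.
  by rewrite invf_plt ?posrE// truncnS_gt.
pose x (j : nat) i : R := j%:R * n0%:R * p i.
pose fr (y : R) := y - (Num.floor y)%:~R.
have fr0 y : 0 <= fr y by rewrite subr_ge0 floor_le.
have fr1 y : fr y < 1 by have := floorD1_gt y; rewrite intrD mulr1z ltrBlDl.
have trQ y : (Num.truncn (Q%:R * fr y) < Q)%N.
  rewrite -(ltr_nat R); apply: (@le_lt_trans _ _ (Q%:R * fr y)).
    by rewrite truncn_le mulr_ge0.
  by rewrite gtr_pMr.
(* Q^|I| + 1 points fall into Q^|I| boxes of side 1/Q, so two of them share a box. *)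
pose h (j : 'I_(Q ^ #|I|).+1) : {ffun I -> 'I_Q} := [ffun i => Ordinal (trQ (x j i))].
have [/injectiveP hi|/injectivePn[j1 [j2 j12 hj]]] := boolP (injectiveb h).
  have := leq_card h hi; rewrite card_ord card_ffun card_ord.
  by rewrite ltnn.
wlog lt12 : j1 j2 j12 hj / (j1 < j2)%N.
  move=> H; case: (ltngtP j1 j2) => [lt|lt|/val_inj E]; first exact: (H j1 j2).
    by apply: (H j2 j1) => //; rewrite eq_sym.
  by rewrite E eqxx in j12.
exists ((j2 - j1) * n0)%N; first by rewrite leq_pmull// subn_gt0.
exists (fun i => Num.floor (x j2 i) - Num.floor (x j1 i)) => i.
have -> : ((j2 - j1) * n0)%:R * p i - (Num.floor (x j2 i) - Num.floor (x j1 i))%:~R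
    = fr (x j2 i) - fr (x j1 i).
  rewrite natrM (natrB _ (ltnW lt12)) intrB /fr /x.
  move: ((Num.floor (j2%:R * n0%:R * p i))%:~R : R)
    ((Num.floor (j1%:R * n0%:R * p i))%:~R : R).
  by move: (j1%:R : R) (j2%:R : R) (n0%:R : R) => a b c u v; ring.
apply: lt_trans Qe; rewrite -(ltr_pM2l Q0) mulfV ?gt_eqF//.
rewrite -{1}(ger0_norm (ltW Q0)) -normrM mulrBr.
have /ffunP/(_ i)/(congr1 val) := hj; rewrite !ffunE /= => tE.
have t1 := truncn_itv (mulr_ge0 (ltW Q0) (fr0 (x j1 i))).
have t2 := truncn_itv (mulr_ge0 (ltW Q0) (fr0 (x j2 i))).
move: t1 t2; rewrite tE; set t := Num.truncn _ => /andP[a1 b1] /andP[a2 b2].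
rewrite ltr_norml; move: b1 b2; rewrite -natr1; lra.
Qed.

Lemma natr_dist_lt1 (a b : nat) : `|a%:R - b%:R| < 1 :> R -> a = b.
Proof.
rewrite ltr_norml => /andP[ab ba]; case: (ltngtP a b) => // lt.
  have : a%:R + 1 <= b%:R :> R by rewrite natr1 ler_nat.
  by move=> H; exfalso; move: ab ba H; lra.
have : b%:R + 1 <= a%:R :> R by rewrite natr1 ler_nat.
by move=> H; exfalso; move: ab ba H; lra.
Qed.

(** The two integers differ by less than (|J| + 1) e <= 1. This makes entries rounded separately
    satisfy the marginal equations exactly. *)
Lemma sum_round (J : finType) (f : J -> nat) (g : J -> R) (N : nat) (a e : R) :
    \sum_j g j = a -> (forall j, `|g j - (f j)%:R| < e) -> `|a - N%:R| < e ->
    #|J|.+1%:R * e <= 1 ->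
  (\sum_j f j)%N = N.
Proof.
move=> ga fg aN Je; apply: natr_dist_lt1; apply: lt_le_trans Je.
rewrite natr_sum -(subrK a (\sum_j (f j)%:R)) -addrA.
apply: (le_lt_trans (ler_normD _ _)); rewrite -natr1 mulrDl mul1r.
apply: ler_ltD => //; rewrite -ga -sumrB mulr_natl -sumr_const.
apply: (le_trans (ler_norm_sum _ _ _)); apply: ler_sum => j _.
by rewrite distrC ltW.
Qed.

Lemma round_joint_types (K : finType) (r : nat) (p : K -> R) (q : 'I_r -> K * K -> R)
    (e : R) (n0 : nat) :
    (forall k, 0 <= p k) -> (forall i x, 0 <= q i x) -> \sum_k p k = 1 ->
    (forall i k, \sum_l q i (k, l) = p k) ->
    (forall i l, \sum_k q i (k, l) = p l) -> 0 < e -> (0 < n0)%N ->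
  exists2 n, (n0 <= n)%N & exists N : K -> nat, exists W : 'I_r -> K * K -> nat,
    [/\ (\sum_k N k)%N = n,
        (forall i k, \sum_l W i (k, l) = N k)%N,
        (forall i l, \sum_k W i (k, l) = N l)%N &
      [/\ forall k, `|n%:R * p k - (N k)%:R| < e,
        forall i x, `|n%:R * q i x - (W i x)%:R| < e &
        forall i x, q i x = 0 -> W i x = 0%N]].
Proof.
move=> p0 q0 p1 ql qr e0 n00.
(* Small enough for [sum_round] over K, and at most 1, so that null entries round to 0. *)
pose e' := Num.min e #|K|.+1%:R^-1.
have e'0 : 0 < e' by rewrite lt_min e0 invr_gt0 ltr0n.
have e'e : e' <= e by rewrite /e' ge_min lexx.
have e'K : #|K|.+1%:R * e' <= 1 by rewrite mulrC -ler_pdivlMr// div1r /e' ge_min lexx orbT.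
have e'1 : e' <= 1.
  by rewrite /e' ge_min; apply/orP; right; rewrite invf_le1// ler1n.
(* All entries of p and q form one vector, so that a single n serves for all of them. *)
pose v (j : K + 'I_r * (K * K)) : R := match j with inl k => p k | inr ix => q ix.1 ix.2 end.
have [n nn0 [m mP]] := simultaneous_approximation v e'0 n00.
(* The approximated entries are nonnegative and the error is below 1, so each integer m j exceeds -1
   and its absolute value is itself. *)
have m0 j : ((`|m j|%N)%:R : R) = (m j)%:~R.
  have vj : 0 <= n%:R * v j by apply: mulr_ge0 => //; case: j => [k|[i x]] /=.
  have : (-1)%:~R < (m j)%:~R :> R.
    by have := mP j; rewrite ltr_norml => /andP[_]; rewrite intrN; lra.
  by rewrite ltr_int => mj; rewrite natr_absz ger0_norm//; lia.
have Np k : `|n%:R * p k - (`|m (inl k)|%N)%:R| < e' by rewrite m0; exact: mP (inl k).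
have Wq i x : `|n%:R * q i x - (`|m (inr (i, x))|%N)%:R| < e'.
  by rewrite m0; exact: mP (inr (i, x)).
exists n => //; exists (fun k => `|m (inl k)|%N); exists (fun i x => `|m (inr (i, x))|%N).
split.
- apply: (@sum_round _ _ (fun k => n%:R * p k) _ n%:R e') => //.
    by rewrite -mulr_sumr p1 mulr1.
  by rewrite subrr normr0.
- move=> i k; apply: (@sum_round _ _ (fun l => n%:R * q i (k, l)) _ (n%:R * p k) e') => //.
  by rewrite -mulr_sumr ql.
- move=> i l; apply: (@sum_round _ _ (fun k => n%:R * q i (k, l)) _ (n%:R * p l) e') => //.
  by rewrite -mulr_sumr qr.
split=> [k|i x|i x qx]; [exact: lt_le_trans (Np k) e'e|exact: lt_le_trans (Wq i x) e'e|].
apply: natr_dist_lt1; rewrite -normrN opprB; apply: lt_le_trans e'1.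
by have := Wq i x; rewrite qx mulr0.
Qed.

End rounding.

Section asymptotics.
Variable R : realType.

Lemma config_entropy_continuous (K : finType) (r : nat) (p : K -> R)
    (q : 'I_r -> K * K -> R) (e : R) : 0 < e ->
  exists2 d, 0 < d & forall (p' : K -> R) (q' : 'I_r -> K * K -> R),
    (forall k, `|p' k - p k| < d) -> (forall i x, `|q' i x - q i x| < d) ->
    `|config_entropy p' q' - config_entropy p q| <= e.
Proof.
move=> e0; pose c : R := 1 + 2 * r%:R.
have c0 : 0 < c by rewrite ltr_pwDl// mulr_ge0.
have e20 : 0 < e / 2 by rewrite divr_gt0.
have [d1 d10 h1] := sum_eta_continuous p (divr_gt0 e20 c0).
have [d2 d20 h2] := sum_eta_continuous (fun ix : 'I_r * (K * K) => q ix.1 ix.2) e20.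
exists (Num.min d1 d2); first by rewrite lt_min d10.
move=> p' q' pp qq.
have {}h1 : `|\sum_k eta (p' k) - \sum_k eta (p k)| <= e / 2 / c.
  by apply: h1 => k; apply: lt_le_trans (pp k) _; rewrite ge_min lexx.
have {}h2 := h2 (fun ix => q' ix.1 ix.2).
rewrite -(pair_bigA _ (fun i x => eta (q' i x))) in h2.
rewrite -(pair_bigA _ (fun i x => eta (q i x))) /= in h2.
have {}h2 : `|\sum_i \sum_x eta (q' i x) - \sum_i \sum_x eta (q i x)| <= e / 2.
  by apply: h2 => -[i x]; apply: lt_le_trans (qq i x) _; rewrite ge_min lexx orbT.
rewrite /config_entropy !sumrN; move: h1 h2.
move: (\sum_k eta (p' k)) (\sum_k eta (p k)) (\sum_i \sum_x eta (q' i x))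
  (\sum_i \sum_x eta (q i x)) => a a' b b' h1 h2.
have -> : (1 - 2 * r%:R) * - a + - b - ((1 - 2 * r%:R) * - a' + - b')
  = (2 * r%:R - 1) * (a - a') - (b - b') by ring.
apply: (le_trans (ler_normB _ _)); rewrite normrM.
rewrite (splitr e); apply: lerD => //.
apply: (@le_trans _ _ (c * (e / 2 / c))); last by rewrite mulrC divfK ?gt_eqF.
apply: ler_pM => //.
rewrite ler_norml /c; have : (0 : R) <= r%:R by [].
by lra.
Qed.

Lemma log_sublinear (a b e : R) : 0 <= a -> 0 <= b -> 0 < e ->
  exists n0, forall n, (n0 <= n)%N -> a + b * ln n.+1%:R <= e * n%:R.
Proof.
(* With z = sqrt (n + 1) one has ln (n + 1) = 2 ln z <= 2 z, and z >= [z0] gives z >= 1 and (a + 2 b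
   + e) z <= e z^2 = e (n + 1). *)
move=> a0 b0 e0; pose z0 : R := 1 + (a + 2 * b + e) / e.
have z01 : 1 <= z0 by rewrite lerDl divr_ge0 ?ltW//; lra.
exists (Num.truncn (z0 ^+ 2)).+1 => n n0n.
pose z : R := Num.sqrt n.+1%:R.
have zE : n.+1%:R = z ^+ 2 by rewrite sqr_sqrtr.
have zz0 : z0 <= z.
  rewrite -(@ler_pXn2r _ 2) ?nnegrE ?sqrtr_ge0//; last lra.
  rewrite -zE; apply/ltW/(lt_le_trans (truncnS_gt _)).
  by rewrite ler_nat (leq_trans n0n).
have z0' : 0 < z by lra.
have lz : ln z <= z by exact/ltW/ln_sublinear.
have -> : n%:R = z ^+ 2 - 1 by rewrite -zE -natr1 addrK.
rewrite zE lnXn// mulr2n.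
have ez : a + 2 * b + e <= e * z.
  by rewrite [e * z]mulrC -ler_pdivrMr//; apply: le_trans zz0; rewrite lerDr.
have : (a + 2 * b + e) * z <= e * z * z by rewrite ler_wpM2r// ltW.
have : b * ln z <= b * z by rewrite ler_wpM2l.
have : a + e <= (a + e) * z by rewrite ler_peMr//; lra.
by rewrite expr2; lra.
Qed.

End asymptotics.

(** * Weak* neighborhoods and windows *)

Lemma cvg_ptws (U : Type) (V : topologicalType) (F : set_system (U -> V))
    (f : {ptws U -> V}) : Filter F ->
  (forall u, (fun g => g u) @ F --> f u) -> F --> f.
Proof.
move=> FF Ff; apply/cvg_sup => u; apply/cvg_image.
  by apply/seteqP; split=> // v _; exists (fun=> v).
move=> W fW; exists ((fun g => g u) @^-1` W); first exact: (Ff u).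
by apply: image_preimage; apply/seteqP; split=> // v _; exists (fun=> v).
Qed.

Section window.
Variables (G : groupType) (A : alphabetType).
Local Notation X := (fullshift G A).
Implicit Types (D : {fset G}) (x y : X) (C : set X).

Definition agree D x y := forall g, g \in D -> x g = y g.

Definition determined D C := forall x y, agree D x y -> C x -> C y.

Lemma determinedS D D' C : (forall g, g \in D -> g \in D') ->
  determined D C -> determined D' C.
Proof. by move=> DD' CD x y xy; apply: CD => g /DD'; exact: xy. Qed.

Lemma translatesE D x h : translates (@coord1 G A) D x h = x (val h).
Proof. by rewrite ffunE /coord1 /Defs.shift invgK mulg1. Qed.

Lemma translates_agree D x y :
  translates (@coord1 G A) D x = translates (@coord1 G A) D y <-> agree D x y.
Proof.
split=> [xy g gD|xy].
  by have /ffunP/(_ [` gD]%fset) := xy; rewrite !translatesE.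
by apply/ffunP => h; rewrite !translatesE xy //; exact: (valP h).
Qed.

Lemma determined_translates D (P : set {ffun D -> A}) :
  determined D (translates (@coord1 G A) D @^-1` P).
Proof. by move=> x y /translates_agree; rewrite /preimage /= => ->. Qed.

Lemma near_agree D x : \forall y \near x, agree D x y.
Proof.
have near1 g : \forall y \near x, x g = y g.
  have xg : nbhs (x g : discrete_topology A) [set x g] by exact: discrete_set1.
  have : nbhs x (proj g @^-1` [set x g : discrete_topology A]).
    exact: (@proj_continuous G (fun=> discrete_topology A) g x _ xg).
  by apply: filterS => y; exact: esym.
rewrite /agree; elim/fset1U_rect: D => [|g D _ IH].
  by apply: (@filterE _ (nbhs (x : X)) (nbhs_filter _)) => y g; rewrite inE.
near=> y => h; rewrite inE => /orP[|].
  by rewrite inE => /eqP ->; near: y; exact: near1.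
by move: h; near: y.
Unshelve. all: by end_near. Qed.

Lemma determined_open D C : determined D C -> open C.
Proof.
move=> CD; rewrite openE => x Cx; rewrite /interior.
by apply: filterS (near_agree D x) => y xy; exact: CD xy Cx.
Qed.

Lemma determined_measurable D C : determined D C ->
  measurable (C : set (borel X)).
Proof. by move=> /determined_open; exact: sub_sigma_algebra. Qed.

(** With [near_agree], agreement on finite windows gives a neighborhood basis at x: the filter
    generated by these sets converges to x at every coordinate, hence in the product topology. *)
Lemma nbhs_agree x (V : set X) : nbhs x V ->
  exists D, forall y, agree D x y -> V y.
Proof.
pose F : set_system X := filter_from setT (fun D => [set y | agree D x y]).
have FF : Filter F.
  apply: filter_from_filter; first by exists fset0.
  move=> D D' _ _; exists (D `|` D')%fset => // y xy.
  by split=> g gD; apply: xy; rewrite inE gD ?orbT.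
have : F --> x.
  apply: (@cvg_ptws G (discrete_topology A) F x) => g W /= /principal_filterP Wx.
  exists [fset g]%fset => // y /(_ g); rewrite inE eqxx => /(_ isT) /= <-.
  exact: Wx.
by move=> /[apply] -[D _ DV]; exists D.
Qed.

Lemma fullshift_compact : compact [set: X].
Proof.
have fA : finite_set [set: discrete_topology A] := @finite_finset A _.
have := @tychonoff G (fun=> discrete_topology A) (fun=> setT)
  (fun=> finite_compact fA).
by congr compact; apply/seteqP; split.
Qed.

(** Uniform continuity by compactness: each point has a window that works nearby, and the
    near-covering property, along finite windows ordered by inclusion, yields one window for all
    points. *)
Lemma continuous_agree (R : realType) (f : X -> R) (e : R) : continuous f -> 0 < e ->
  exists D, forall x y, agree D x y -> `|f x - f y| < e.
Proof.
move=> cf e0; pose F : set_system {fset G} :=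
  filter_from setT (fun D => [set D' | (D `<=` D')%fset]).
have FF : Filter F.
  apply: filter_from_filter; first by exists fset0.
  move=> D D' _ _; exists (D `|` D')%fset => // D'' /=.
  by rewrite fsubUset => /andP.
have := fullshift_compact; rewrite compact_near_coveringP => nc.
have [] := nc _ F (fun D x => forall y, agree D x y -> `|f x - f y| < e) FF.
  move=> x _; have e20 : 0 < e / 2 by rewrite divr_gt0.
  have /cvgrPdist_lt /(_ _ e20) /nbhs_agree[D DP] := cf x.
  exists ([set y | agree D x y], [set D' | (D `<=` D')%fset]).
    by split; [exact: near_agree|exists D].
  move=> [x' D'] /= [xx' /fsubsetP DD'] y x'y.
  rewrite -(subrK (f x) (f x')) -addrA (splitr e).
  apply: (le_lt_trans (ler_normD _ _)); apply: ltrD; first by rewrite distrC; exact: DP.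
  by apply: DP => g gD; rewrite xx'// x'y// DD'.
by move=> D _ DP; exists D => x y; apply: DP => /=.
Qed.

End window.

Section weak_star.
Variables (R : realType) (G : groupType) (A : alphabetType).
Local Notation X := (fullshift G A).
Implicit Types (D : {fset G}) (C : set X) (mu nu : probability (borel X) R).

Lemma continuous_borel (f : X -> R) : continuous f ->
  measurable_fun setT (f : borel X -> R).
Proof.
move=> /continuousP cf; apply: (measurability _ (measurable_realfun.RGenOpens.measurableE R)).
move=> _ [_ [a [b ->] <-]]; rewrite setTI; apply: sub_sigma_algebra.
by apply: cf; exact: interval_open.
Qed.

Lemma Rintegral_indic mu C : measurable (C : set (borel X)) ->
  Rintegral mu setT (\1_C : borel X -> R) = fine (mu C).
Proof. by move=> mC; rewrite /Rintegral integral_indic// setIT. Qed.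

Lemma Rintegral_sum_indic mu (I : Type) (s : seq I) (c : I -> R) (C : I -> set X) :
    (forall i, measurable (C i : set (borel X))) ->
  mu.-integrable setT (EFin \o (fun x : borel X => \sum_(i <- s) c i * \1_(C i) x)) /\
  Rintegral mu setT (fun x : borel X => \sum_(i <- s) c i * \1_(C i) x)
    = \sum_(i <- s) c i * fine (mu (C i)).
Proof.
move=> mC; elim: s => [|i s [IHi IHe]].
  under eq_fun do rewrite big_nil.
  rewrite big_nil Rintegral_cst// mul0r; split=> //.
  exact: (finite_measure_integrable_cst mu 0).
under eq_fun do rewrite big_cons.
have ii : mu.-integrable setT (EFin \o (\1_(C i) : borel X -> R)) by exact: integrable_indic.
have ci : mu.-integrable setT (EFin \o (fun x : borel X => c i * \1_(C i) x)).
  rewrite (_ : _ \o _ = fun x : borel X => ((c i)%:E * (\1_(C i) x)%:E)%E).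
    exact: integrableZl.
  by apply/funext => x /=; rewrite EFinM.
split.
  rewrite (_ : _ \o _ = (EFin \o (fun x : borel X => (c i * \1_(C i) x)%R)) \+
    (EFin \o (fun x : borel X => (\sum_(j <- s) c j * \1_(C j) x)%R)))%E.
    exact: integrableD.
  by apply/funext => x /=; rewrite EFinD.
by rewrite RintegralD// IHe big_cons RintegralZl// Rintegral_indic.
Qed.

(** A representative of the cylinder of w, filled with [point] outside D. *)
Definition extend D (w : {ffun D -> A}) : X :=
  fun g => if insub g is Some h then w h else point.

Lemma extend_agree D (x : X) : agree D x (extend (translates (@coord1 G A) D x)).
Proof.
move=> g gD; rewrite /extend; case: insubP => [h _ <-|/negP//].
by rewrite translatesE.
Qed.

Definition cyl D (w : {ffun D -> A}) : set X := translates (@coord1 G A) D @^-1` [set w].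

Lemma measurable_cyl D w : measurable (@cyl D w : set (borel X)).
Proof. by apply: (@determined_measurable _ _ D); exact: determined_translates. Qed.

(** The sum is the integral of the step function g whose value at x is that of f at the
    representative of the D-pattern of x; f and g differ by less than e everywhere. *)
Lemma Rintegral_cyl_approx mu (f : X -> R) D (e : R) : continuous f ->
    (forall x y, agree D x y -> `|f x - f y| < e) ->
  `|Rintegral mu setT (f : borel X -> R)
    - \sum_(w : {ffun D -> A}) f (extend w) * fine (mu (cyl w))| <= e.
Proof.
move=> cf fD; have [gi gE] := @Rintegral_sum_indic mu _ (index_enum {ffun D -> A})
  (fun w => f (extend w)) (fun w => cyl w) (@measurable_cyl D).
rewrite -gE; set g := fun x => _ in gi gE *.
have gx x : g x = f (extend (translates (@coord1 G A) D x)).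
  rewrite /g (bigD1 (translates (@coord1 G A) D x)) //= indicE mem_set// mulr1.
  rewrite big1 ?addr0// => w wx; rewrite indicE memNset ?mulr0// /cyl /= => xw.
  by rewrite xw eqxx in wx.
have fg x : `|f x - g x| < e by rewrite gx; apply: fD; exact: extend_agree.
have fi : mu.-integrable setT (EFin \o (f : borel X -> R)).
  apply: measurable_bounded_integrable => //; first by rewrite ltey_eq fin_num_measure.
    exact: continuous_borel.
  (* f stays within e of g, which has finitely many values, so this bounds |f|. *)
  exists (\sum_(w : {ffun D -> A}) `|f (extend w)| + e); split; first exact: num_real.
  move=> M fM x _ /=; apply/ltW; apply: le_lt_trans fM.
  rewrite -(subrK (g x) (f x)) addrC; apply: (le_trans (ler_normD _ _)).
  apply: lerD; last exact/ltW.
  by rewrite gx (bigD1 (translates (@coord1 G A) D x)) //= lerDl sumr_ge0.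
rewrite -RintegralB//.
have fgi : mu.-integrable setT (EFin \o (fun x : borel X => f x - g x)).
  rewrite (_ : _ \o _ = (EFin \o (f : borel X -> R)) \- (EFin \o g))%E.
    exact: integrableB.
  by apply/funext => x /=; rewrite EFinB.
apply: (le_trans (le_normr_Rintegral _ _)) => //.
apply: (@le_trans _ _ (Rintegral mu setT (cst e : borel X -> R))).
  apply: le_Rintegral => //; [exact: integrable_norm|exact: finite_measure_integrable_cst|].
  by move=> x _; exact/ltW.
rewrite Rintegral_cst// (_ : fine _ = 1) ?mulr1//.
by rewrite -[RHS]/(fine 1%E); congr fine; exact: probability_setT.
Qed.

(** One index governs both the window and the tolerance, so that for increasing windows these sets
    decrease and generate a filter. *)
Definition window_ball (s : nat -> {fset G}) mu (n : nat) : set (probability (borel X) R) :=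
  [set nu | forall C, determined (s n) C ->
    `|fine (nu C) - fine (mu C)| < n.+1%:R^-1].

(** The filter generated by the window balls converges to mu weak*: this is tested on each
    continuous f, whose integral is nearly a combination of cylinder probabilities. *)
Lemma weakstar_window (s : nat -> {fset G}) mu (O : set (Prob X R)) :
    (forall m n, (m <= n)%N -> (s m `<=` s n)%fset) ->
    (forall D, exists n, (D `<=` s n)%fset) ->
    open O -> O mu ->
  exists n, window_ball s mu n `<=` O.
Proof.
move=> sS sD oO Omu; pose F := filter_from setT (window_ball s mu).
have FF : Filter F.
  apply: filter_from_filter; first by exists 0%N.
  have sub m n : (m <= n)%N -> window_ball s mu n `<=` window_ball s mu m.
    move=> mn nu nuC C CD; apply: (lt_le_trans (nuC C _)); last first.
      by rewrite lef_pV2 ?posrE// ler_nat.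
    by apply: determinedS CD; exact/fsubsetP/sS.
  move=> m n _ _; exists (maxn m n) => // nu H.
  by split; apply: sub H; rewrite (leq_maxl, leq_maxr).
suff : F --> (mu : Prob X R).
  by move=> /(_ O (open_nbhs_nbhs (conj oO Omu))) [n _ nO]; exists n.
suff ev : (@weakstar_eval X R) @ F --> @weakstar_eval X R mu.
  move=> V /= [W [[W' oW' <-] Wmu] WV].
  have : nbhs (@weakstar_eval X R mu) W' by exact: open_nbhs_nbhs.
  by move=> /ev; exact: (@filterS _ F FF _ _ WV).
apply: (@cvg_ptws (continuousType X R) R) => f.
have cf : continuous (f : X -> R) by exact: cts_fun.
apply/cvgrPdist_le => e e0.
have e30 : 0 < e / 3 by rewrite divr_gt0.
have [D fD] := continuous_agree cf e30.
have [m Dm] := sD D.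
pose M := \sum_(w : {ffun D -> A}) `|f (extend w)|.
(* Large enough for the window to contain D and for M / (n + 1) <= e / 3, the error committed on the
   cylinder probabilities. *)
pose n := maxn m (Num.truncn (M / (e / 3))).
exists n => // nu nuC /=; rewrite /weakstar_eval.
have mua := Rintegral_cyl_approx mu cf fD.
have nua := Rintegral_cyl_approx nu cf fD.
set a := Rintegral mu _ _ in mua *; set b := Rintegral nu _ _ in nua *.
set a' := \sum_w _ in mua; set b' := \sum_w _ in nua.
have ab : `|a' - b'| <= e / 3.
  rewrite /a' /b' -sumrB; apply: (le_trans (ler_norm_sum _ _ _)).
  apply: (@le_trans _ _ (\sum_(w : {ffun D -> A}) `|f (extend w)| * n.+1%:R^-1)).
    apply: ler_sum => w _; rewrite -mulrBr normrM ler_wpM2l// distrC; apply/ltW/nuC.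
    apply: determinedS (@determined_translates _ _ _ _) => g gD.
    by have /fsubsetP := sS m n (leq_maxl _ _); apply; exact: (fsubsetP Dm).
  rewrite -mulr_suml ler_pdivrMr// mulrC -ler_pdivrMr//.
  apply/ltW/(lt_le_trans (truncnS_gt _)); rewrite ler_nat ltnS; exact: leq_maxr.
have -> : a - b = (a - a') + (a' - b') - (b - b') by ring.
apply: (le_trans (ler_normB _ _)).
apply: (le_trans (lerD (ler_normD _ _) (lexx _))); lra.
Qed.

(** The indicator of a set determined by a finite window is continuous, so its integral is a weak*
    continuous functional. *)
Lemma near_weakstar mu C D (e : R) : determined D C -> 0 < e ->
  \forall nu \near (mu : Prob X R),
    `|fine ((nu : probability (borel X) R) C) - fine (mu C)| < e.
Proof.
move=> CD e0.
have cC : continuous (\1_C : X -> R).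
  move=> x; apply: (@cvg_near_cst X R _ _ (nbhs (x : X)) (nbhs_filter _)).
  move: (near_agree D x); apply: (@filterS _ (nbhs (x : X)) (nbhs_filter _)) => y xy.
  rewrite !indicE; congr (nat_of_bool _)%:R.
  apply/idP/idP => /set_mem H; apply/mem_set; apply: CD H => // g gD; by rewrite xy.
pose f : continuousType X R := mkcts cC.
have pc := @proj_continuous _ (fun=> R) f (@weakstar_eval X R mu).
have ic := @initial_continuous _ _ (@weakstar_eval X R) mu.
have : (fun nu : Prob X R => proj f (@weakstar_eval X R nu)) x @[x --> (mu : Prob X R)]
    --> weakstar_eval mu f by apply: (cvg_comp _ _ ic pc).
move=> /cvgrPdist_lt /(_ e e0).
have mC := determined_measurable CD.
apply: (@filterS _ (nbhs (mu : Prob X R)) (nbhs_filter _)) => nu.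
rewrite /proj /weakstar_eval distrC.
by rewrite ![Rintegral _ _ _](Rintegral_indic _ mC).
Qed.

End weak_star.

Section finite_observables.
Variables (R : realType) (G : groupType) (A : alphabetType).
Local Notation X := (fullshift G A).
Implicit Types (mu : probability (borel X) R).

Lemma fine_measure_partition mu (L : finType) (psi : X -> L) (C : set X) :
    (forall l, measurable (C `&` psi @^-1` [set l] : set (borel X))) ->
  fine (mu C) = \sum_l fine (mu (C `&` psi @^-1` [set l])).
Proof.
move=> mCl; have CE : \1_C = (fun x : borel X =>
    \sum_(l : L) 1 * \1_(C `&` psi @^-1` [set l]) x) :> (X -> R).
  apply/funext => x; rewrite (bigD1 (psi x)) //= big1 ?addr0 ?mul1r; last first.
    by move=> l /eqP lx; rewrite indicE memNset ?mulr0// => -[_ /= xl]; exact/lx.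
  rewrite !indicE; congr (nat_of_bool _)%:R.
  by apply/idP/idP => /set_mem H; apply/mem_set; [split|case: H].
have mC : measurable (C : set (borel X)).
  have -> : C = \bigcup_(l in [set: L]) (C `&` psi @^-1` [set l]).
    by apply/seteqP; split=> [x Cx|x [l _ []]//]; exists (psi x).
  by apply: fin_bigcup_measurable => //; exact: finite_finset.
have [_] := @Rintegral_sum_indic R G A mu _ (index_enum L) (fun=> 1) _ mCl.
rewrite -CE Rintegral_indic// => ->.
by apply: eq_bigr => l _; rewrite mul1r.
Qed.

Lemma shannonE mu (B : finType) (phi : X -> B) :
  shannon mu phi = - \sum_b eta (fine (mu (phi @^-1` [set b]))).
Proof. by []. Qed.

Lemma shannon_inj mu (B B' : finType) (phi : X -> B) (g : B -> B') :
  injective g -> shannon mu (g \o phi) = shannon mu phi.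
Proof.
move=> gi; rewrite !shannonE; congr (- _).
rewrite [RHS](partition_big g xpredT) //=; apply: eq_bigr => b' _.
case: (pickP (fun b => g b == b')) => [b /eqP <-|gb].
  rewrite (eq_bigl (pred1 b)) => [|b1]; last by rewrite /= (inj_eq gi).
  rewrite big_pred1_eq; congr (eta (fine (mu _))).
  by apply/seteqP; split=> x /= => [/gi|->].
(* A label outside the image of g has empty preimage and contributes eta(0) = 0. *)
rewrite big_pred0// [_ @^-1` _](_ : _ = set0) ?measure0 ?eta0//.
by apply/seteqP; split=> // x /= xb; have := gb (phi x); rewrite xb eqxx.
Qed.

End finite_observables.

(** * Distributions of patterns and of pairs of patterns *)

Section window_types.
Variables (R : realType) (G : groupType) (r : nat) (s : 'I_r -> G) (A : alphabetType).
Variable D : {fset G}.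
Local Notation X := (fullshift G A).
Local Notation K := {ffun D -> A}.
Implicit Types (mu : probability (borel X) R).
Local Notation obs := (translates (@coord1 G A) D).

(** The observable phi^{e, s_i} for the window pattern phi, written as a pair. *)
Definition pair_obs (i : 'I_r) (x : X) : K * K := (obs x, obs (Defs.shift (s i)^-1%g x)).

Definition window_prob mu (k : K) : R := fine (mu (cyl k)).

Definition pair_prob mu (i : 'I_r) (kl : K * K) : R :=
  fine (mu (pair_obs i @^-1` [set kl])).

(** Evaluation at 1 and s i turns functions on {1, s i} into pairs injectively, and an injective
    relabeling preserves entropy. *)
Lemma F_functionalE mu :
  F_functional s mu obs = config_entropy (window_prob mu) (pair_prob mu).
Proof.
rewrite /F_functional /config_entropy shannonE; congr (_ * _ + _).
apply: eq_bigr => i _; rewrite -[RHS](shannonE mu (pair_obs i)).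
have s1 : 1%g \in [fset 1%g; s i]%fset by rewrite !inE eqxx.
have s2 : s i \in [fset 1%g; s i]%fset by rewrite !inE eqxx orbT.
pose g (u : {ffun [fset 1%g; s i]%fset -> K}) := (u [` s1]%fset, u [` s2]%fset).
have gi : injective g.
  move=> u v [uv1 uv2]; apply/ffunP => -[h hP]; have := hP; rewrite !inE => /orP[]/eqP hE.
    by move: uv1; rewrite (_ : [` s1]%fset = [` hP]%fset)//; apply/val_inj.
  by move: uv2; rewrite (_ : [` s2]%fset = [` hP]%fset)//; apply/val_inj.
rewrite -(shannon_inj mu _ gi); congr (shannon mu _); apply/funext => x.
rewrite /g /= /pair_obs !ffunE /=; congr (obs _, _).
by apply/funext => h; rewrite /Defs.shift !invg1 mul1g.
Qed.

Lemma determined_cyl k : determined D (@cyl G A D k).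
Proof. exact: determined_translates. Qed.

Definition pair_window i : {fset G} := (D `|` [fset (s i * h)%g | h in D])%fset.

Lemma obs_shiftE g x h : obs (Defs.shift g^-1%g x) h = x (g * val h)%g.
Proof. by rewrite translatesE /Defs.shift invgK. Qed.

Lemma determined_pair_obs i (P : set (K * K)) :
  determined (pair_window i) (pair_obs i @^-1` P).
Proof.
move=> x y xy; rewrite /preimage /= (_ : pair_obs i x = pair_obs i y)//.
congr (_, _).
  by apply/translates_agree => g gD; apply: xy; rewrite inE gD.
apply/ffunP => h; rewrite !obs_shiftE xy// inE; apply/orP; right.
by apply/imfsetP; exists (val h) => //; exact: (valP h).
Qed.

Lemma measurable_pair_obs i P : measurable (pair_obs i @^-1` P : set (borel X)).
Proof. by apply: (@determined_measurable _ _ (pair_window i)); exact: determined_pair_obs. Qed.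

Lemma window_prob_ge0 mu k : 0 <= window_prob mu k.
Proof. exact: fine_ge0. Qed.

Lemma pair_prob_ge0 mu i x : 0 <= pair_prob mu i x.
Proof. exact: fine_ge0. Qed.

(** A set determined by D is a disjoint union of cylinders over D, and it contains a cylinder as
    soon as it contains its representative. *)
Lemma fine_determined mu (C : set X) : determined D C ->
  fine (mu C) = \sum_(k | `[< C (extend k) >]) window_prob mu k.
Proof.
move=> CD; rewrite (@fine_measure_partition _ _ _ mu _ obs); last first.
  move=> k; apply: (@determined_measurable _ _ D) => x y xy [Cx kx].
  by split; [exact: CD xy Cx|exact: determined_translates xy kx].
rewrite [RHS]big_mkcond; apply: eq_bigr => k _; case: asboolP => Ck.
  congr (fine (mu _)); apply/seteqP; split=> x /=; first by case.
  move=> kx; split=> //; apply: CD Ck; rewrite -kx => g gD.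
  by rewrite -(extend_agree x).
rewrite (_ : _ `&` _ = set0) ?measure0//; apply/seteqP; split=> // x [Cx /= kx].
by apply: Ck; apply: CD Cx; rewrite -kx; exact: extend_agree.
Qed.

Lemma sum_window_prob mu : \sum_k window_prob mu k = 1.
Proof.
rewrite -[RHS]/(fine 1%E) -(probability_setT mu) (@fine_determined mu setT)//.
by apply: eq_bigl => k; apply/esym/asboolP.
Qed.

Lemma sum_pair_prob_l mu i k : \sum_l pair_prob mu i (k, l) = window_prob mu k.
Proof.
rewrite /window_prob (@fine_measure_partition _ _ _ mu _ (fun x => (pair_obs i x).2)).
  apply: eq_bigr => l _; congr (fine (mu _)); apply/seteqP; split=> x /=.
    by case.
  by move=> [? ?]; rewrite /pair_obs; congr (_, _).
move=> l; rewrite (_ : _ `&` _ = pair_obs i @^-1` [set (k, l)]).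
  exact: measurable_pair_obs.
apply/seteqP; split=> x /=; last by case.
by move=> [? ?]; rewrite /pair_obs; congr (_, _).
Qed.

(** Here invariance enters: the second component is the pattern of a shifted point. *)
Lemma sum_pair_prob_r mu i l : shift_invariant mu ->
  \sum_k pair_prob mu i (k, l) = window_prob mu l.
Proof.
move=> inv; rewrite /window_prob -(inv (s i)^-1%g); last exact: measurable_cyl.
rewrite (@fine_measure_partition _ _ _ mu _ (fun x => (pair_obs i x).1)).
  apply: eq_bigr => k _; congr (fine (mu _)); apply/seteqP; split=> x /=.
    by case.
  by move=> [? ?]; rewrite /pair_obs; congr (_, _).
move=> k; rewrite (_ : _ `&` _ = pair_obs i @^-1` [set (k, l)]).
  exact: measurable_pair_obs.
apply/seteqP; split=> x /=; last by case.
by move=> [? ?]; rewrite /pair_obs; congr (_, _).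
Qed.

End window_types.

(** * Microstates *)

Section names.
Variables (R : realType) (G : groupType) (r : nat) (s : 'I_r -> G) (A : alphabetType).
Hypothesis fs : free_basis s.
Variables (n : nat) (rho : nat).
Local Notation X := (fullshift G A).
Local Notation D := (Defs.ball s rho).
Local Notation K := {ffun D -> A}.
Local Notation obs := (translates (@coord1 G A) D).
Local Notation T := {ffun 'I_r -> {perm 'I_n.+1}}.
Implicit Types (t : T) (x : {ffun 'I_n.+1 -> A}).

Definition name t x v : X := pullback_name (sym_hom fs t) x v.

Lemma nameE t x v g : name t x v g = x (perm_hom fs t g v).
Proof. by rewrite /name /pullback_name /sym_hom invgK. Qed.

Lemma shift_name t x v g :
  Defs.shift g^-1%g (name t x v) = name t x (perm_hom fs t g v).
Proof.
by apply/funext => h; rewrite /Defs.shift invgK !nameE perm_homM permM.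
Qed.

Definition names t x : {ffun 'I_n.+1 -> K} := [ffun v => obs (name t x v)].

Lemma names1 t x v h : val h = 1%g -> names t x v h = x v.
Proof. by move=> h1; rewrite ffunE translatesE h1 nameE perm_hom1 perm1. Qed.

Lemma joint_names t x i v :
  joint (names t x) (fperm (names t x) (t i)) v = pair_obs s D i (name t x v).
Proof. by rewrite !ffunE /pair_obs shift_name perm_homE. Qed.

Lemma empiricalE t x (C : set X) :
  fine (@empirical R G A n (sym_hom fs t) x C)
    = #|[set v | `[< C (name t x v) >]]%SET|%:R / n.+1%:R.
Proof.
rewrite /empirical mulrC; rewrite (eq_bigr (fun v => (`[< C (name t x v) >]%:R : R)%:E)).
  rewrite sumEFin /= -sum1_card natr_sum [in RHS]big_mkcond; congr (_ * _).
  by apply: eq_bigr => v _; rewrite inE; case: asboolP.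
by move=> v _; rewrite diracE.
Qed.

Lemma window_prob_empirical t x k :
  window_prob (@empirical_prob R G A n (sym_hom fs t) x) k
    = (occ (names t x) k)%:R / n.+1%:R.
Proof.
rewrite /window_prob empiricalE; congr (_%:R / _); apply: eq_card => v.
by rewrite !inE /cyl ffunE; apply/asboolP/eqP.
Qed.

Lemma pair_prob_empirical t x i kl :
  pair_prob s (@empirical_prob R G A n (sym_hom fs t) x) i kl
    = (occ (joint (names t x) (fperm (names t x) (t i))) kl)%:R / n.+1%:R.
Proof.
rewrite /pair_prob empiricalE; congr (_%:R / _); apply: eq_card => v.
by rewrite !inE joint_names; apply/asboolP/eqP.
Qed.

(** The pattern at v records x v at the identity, which lies in every ball. *)
Lemma names_inj : injective (fun tx : T * {ffun 'I_n.+1 -> A} => (tx.1, names tx.1 tx.2)).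
Proof.
move=> [t x] [t' x'] [<- /ffunP nn]; congr (_, _); apply/ffunP => v.
by have := nn v => /ffunP/(_ [` one_in_ball s rho]%fset); rewrite !names1.
Qed.

(* Consistency propagates along words: every suffix of a word spelling an
   element of the ball lies in the ball. *)
Lemma names_of_consistent t (y : {ffun 'I_n.+1 -> K}) :
    (forall i v, exists z : X, pair_obs s D i z = (y v, y (t i v))) ->
  exists x, names t x = y.
Proof.
move=> cons; pose h1 : D := [` one_in_ball s rho]%fset.
exists [ffun v => y v h1]; apply/ffunP => v; rewrite ffunE; apply/ffunP => h.
rewrite translatesE nameE ffunE.
have step i u g g' : val g = (s i * val g')%g -> y u g = y (t i u) g'.
  move=> gg'; have [z [zu zt]] := cons i u.
  by rewrite -zu -zt translatesE obs_shiftE gg'.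
have key w : (size w <= rho)%N -> forall u (g : D), val g = word s w ->
    y u g = y (perm_hom fs t (word s w) u) h1.
  elim: w => [|[i b] w IHw] wrho u g gE.
    rewrite /word big_nil perm_hom1 perm1.
    by congr (y u _); apply/val_inj; rewrite gE /word big_nil.
  have wD : word s w \in D by apply/in_ball; exists w; rewrite ltnW.
  pose g' : D := [` wD]%fset.
  rewrite word_cons perm_homM permM -(IHw (ltnW wrho) _ g')//.
  rewrite word_cons in gE; case: b gE {wrho} => gE; rewrite /letter /= in gE *.
    by rewrite perm_homE; apply: step.
  rewrite perm_homV perm_homE; apply/esym.
  (* For an inverse letter, consistency is applied at the vertex (t i)^-1 u and read in the opposite
     direction. *)
  have -> : y u g = y (t i ((t i)^-1%g u)) g by rewrite permKV.
  by apply: step; rewrite /= gE mulKVg.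
have [w [wrho hw]] : exists w, (size w <= rho)%N /\ val h = word s w by apply/in_ball/valP.
by rewrite hw -(key w wrho v h hw).
Qed.

End names.

Section limsup.
Variable R : realType.
Implicit Types (u : (\bar R)^nat) (l : \bar R).

Lemma limn_esup_le_near u l n0 : (forall n, (n0 <= n)%N -> (u n <= l)%E) ->
  (limn_esup u <= l)%E.
Proof.
move=> ul; apply: (@le_trans _ _ (ereal_sup (u @` [set n | (n0 <= n)%N]))).
  by apply: ereal_inf_lbound; exists [set n | (n0 <= n)%N] => //; exists n0.
by apply: ge_ereal_sup => _ [n n0n <-]; exact: ul.
Qed.

Lemma limn_esup_ge_frequently u l :
  (forall n0, exists2 n, (n0 <= n)%N & (l <= u n)%E) -> (l <= limn_esup u)%E.
Proof.
move=> ul; apply: le_ereal_inf_tmp => _ [V [n0 _ n0V] <-].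
have [n n0n lun] := ul n0; apply: (le_trans lun).
by apply: ereal_sup_ubound; exists n => //; exact: n0V.
Qed.

End limsup.

Section config_bounds.
Variables (R : realType) (K : finType) (r n : nat).
Hypothesis n0 : (0 < n)%N.
Local Notation T := {ffun 'I_r -> {perm 'I_n}}.
Variables (N : K -> nat) (W : 'I_r -> K * K -> nat).
Hypotheses (sumN : (\sum_k N k)%N = n)
  (Wl : forall i k, (\sum_l W i (k, l) = N k)%N)
  (Wr : forall i l, (\sum_k W i (k, l) = N l)%N).
Local Notation CE := (@config_entropy R K r (fun k => (N k)%:R / n%:R)
  (fun i x => (W i x)%:R / n%:R)).
Local Notation cnt := (#|configurations n N W|%:R : R).

Lemma card_configurations_gt0 : (0 < #|configurations n N W|)%N.
Proof.
have := card_configurations sumN Wl Wr.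
case: posnP => // ->; rewrite !mul0n => /esym/eqP.
rewrite muln_eq0 -leqn0 leqNgt fact_gt0 /= expn_eq0 => /andP[/eqP H _].
have : (0 < \prod_k (N k)`!)%N by apply: prodn_gt0 => k; exact: fact_gt0.
by rewrite H.
Qed.

Let rat0 : 0 < cnt / n`!%:R ^+ r.
Proof. by rewrite divr_gt0// ?exprn_gt0// ltr0n ?card_configurations_gt0// fact_gt0. Qed.

Lemma card_configurations_le :
  cnt / n`!%:R ^+ r <= expR (n%:R * CE + config_err R K r n).
Proof.
rewrite -ler_ln ?posrE ?expR_gt0// expRK -lerBlDl.
by apply: (le_trans (ler_norm _)); exact: ln_card_configurations.
Qed.

Lemma card_configurations_ge :
  expR (n%:R * CE - config_err R K r n) <= cnt / n`!%:R ^+ r.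
Proof.
rewrite -ler_ln ?posrE ?expR_gt0// expRK lerBlDl -lerBlDr.
apply: (le_trans (ler_norm _)); rewrite -normrN opprB.
exact: ln_card_configurations.
Qed.

End config_bounds.

(** * Microstates counted through their types *)

Section bounds.
Variables (R : realType) (G : groupType) (r : nat) (s : 'I_r -> G) (A : alphabetType).
Hypothesis fs : free_basis s.
Local Notation X := (fullshift G A).
Implicit Types (mu : probability (borel X) R) (Z : set X) (O : set (Prob X R)).

Definition microstate_pairs Z O n :
    {set {ffun 'I_r -> {perm 'I_n.+1}} * {ffun 'I_n.+1 -> A}} :=
  [set tx : {ffun 'I_r -> {perm 'I_n.+1}} * {ffun 'I_n.+1 -> A} |
    tx.2 \in microstates_in Z (sym_hom fs tx.1) O]%SET.

Lemma expectation_microstates Z O n :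
  uniform_expectation (@Hom_sym G n.+1)
    (fun sigma => #|microstates_in Z sigma O|%:R : R)
  = #|microstate_pairs Z O n|%:R / (n.+1)`!%:R ^+ r.
Proof.
rewrite (uniform_expectation_sym_hom fs) natrX -natr_sum; congr (_%:R / _).
rewrite -sum1_card (partition_big (fun tx => tx.1) xpredT) //=.
apply: eq_bigr => t _; rewrite sum1_card.
have pi : injective (fun x : {ffun 'I_n.+1 -> A} => (t, x)) by move=> x x' [].
rewrite -[LHS](card_imset _ pi); apply: eq_card => -[t' x].
rewrite [RHS]unfold_in /= inE /=; apply/imsetP/andP => [[x' xM [-> ->]]//|[xM /eqP tt]].
by exists x; rewrite -tt.
Qed.

Section upper.
Variables (rho n : nat).
Local Notation K := {ffun Defs.ball s rho -> A}.
Local Notation C := ({ffun 'I_r -> {perm 'I_n.+1}} * {ffun 'I_n.+1 -> K})%type.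
Local Notation dat := ({ffun K -> 'I_n.+2} * {ffun 'I_r * (K * K) -> 'I_n.+2})%type.

(** The type of a configuration, as an element of a finite type so that types can be counted. On n +
    1 vertices all counts lie in 0, ..., n + 1, hence in ['I_n.+2]. *)
Definition config_data (c : C) : dat :=
  ([ffun k => inord (occ c.2 k)],
   [ffun ix => inord (occ (joint c.2 (fperm c.2 (c.1 ix.1))) ix.2)]).

Lemma occ_le (L : finType) (y : {ffun 'I_n.+1 -> L}) l : (occ y l < n.+2)%N.
Proof. by rewrite ltnS -[leqRHS]card_ord max_card. Qed.

(** Pairs are replaced injectively by configurations and sorted by type. A type that occurs is that
    of some microstate, whose empirical measure lies in O, so the entropy of the type is at most
    h. *)
Lemma card_microstate_pairs_le Z O (h : R) :
    (forall nu, O nu ->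
       config_entropy (window_prob (D := Defs.ball s rho) nu) (pair_prob s nu) <= h) ->
  #|microstate_pairs Z O n|%:R / (n.+1)`!%:R ^+ r
    <= #|{: dat}|%:R * expR (n.+1%:R * h + config_err R K r n.+1).
Proof.
move=> Oh; pose nm (tx : {ffun 'I_r -> {perm 'I_n.+1}} * {ffun 'I_n.+1 -> A}) : C :=
  (tx.1, names fs rho tx.1 tx.2).
set S := microstate_pairs Z O n.
rewrite -(card_imset (mem S) (@names_inj _ _ s A fs n rho)) -/nm.
rewrite -sum1_card (partition_big config_data xpredT) //= natr_sum mulr_suml.
rewrite mulr_natl -sumr_const; apply: ler_sum => d _; rewrite sum1_card.
pose Sd := [pred c | (c \in (nm @: mem S)%SET) && (config_data c == d)].
rewrite -[X in X%:R]/(#|Sd|); have [c0 c0S|S0] := pickP Sd; last first.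
  by rewrite (eq_card0 S0) mul0r expR_ge0.
have [/imsetP[[t x] xS c0E] /eqP c0d] := andP c0S.
pose N k := occ c0.2 k.
pose W i kl := occ (joint c0.2 (fperm c0.2 (c0.1 i))) kl.
have sub : (#|Sd| <= #|configurations n.+1 N W|)%N.
  apply/subset_leq_card/fintype.subsetP => c /andP[_ /eqP].
  rewrite -c0d => -[/ffunP cN /ffunP cW]; rewrite inE; apply/andP; split.
    apply/forallP => k; have /(congr1 val) := cN k.
    by rewrite !ffunE /= !inordK ?occ_le// => ->.
  apply/forallP => i; apply/forallP => kl; have /(congr1 val) := cW (i, kl).
  by rewrite !ffunE /= !inordK ?occ_le// => ->.
have sumN : (\sum_k N k)%N = n.+1 by exact: sum_occ.
have Wl i k : (\sum_l W i (k, l) = N k)%N by exact: occ_joint_l.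
have Wr i l : (\sum_k W i (k, l) = N l)%N by rewrite occ_joint_r occ_fperm.
apply: (@le_trans _ _ (#|configurations n.+1 N W|%:R / (n.+1)`!%:R ^+ r)).
  by rewrite ler_wpM2r ?invr_ge0 ?exprn_ge0// ler_nat.
apply: (le_trans (card_configurations_le R (ltn0Sn n) sumN Wl Wr)).
rewrite ler_expR lerD2r ler_wpM2l//.
move: xS; rewrite inE /= inE => /andP[+ _]; rewrite inE => /asboolP/Oh.
congr (_ <= _); congr config_entropy.
  by apply/funext => k; rewrite window_prob_empirical /N c0E.
apply/funext => i; apply/funext => kl.
by rewrite (pair_prob_empirical _ fs) /W c0E.
Qed.

End upper.

End bounds.

(** * Upper and lower bounds for the growth rate *)

Section growth.
Variables (R : realType) (G : groupType) (r : nat) (s : 'I_r -> G) (A : alphabetType).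
Hypothesis fs : free_basis s.
Local Notation X := (fullshift G A).
Implicit Types (mu : probability (borel X) R) (Z : set X) (O : set (Prob X R)).

Lemma growth_rate_le Z mu rho (e : R) : 0 < e ->
  exists O, [/\ open O, O mu &
    (growth_rate_in Z O <= (config_entropy
      (window_prob (D := Defs.ball s rho) mu) (pair_prob s mu) + e)%:E)%E].
Proof.
move=> e0; set D := Defs.ball s rho; set F := config_entropy _ _.
have e20 : 0 < e / 2 by rewrite divr_gt0.
have [d d0 dP] := config_entropy_continuous
  (window_prob (D := D) mu) (pair_prob (D := D) s mu) e20.
pose V : set (Prob X R) := [set nu : probability (borel X) R |
    (forall k, `|window_prob (D := D) nu k - window_prob mu k| < d) /\
    (forall ix : 'I_r * ({ffun D -> A} * {ffun D -> A}),
       `|pair_prob (D := D) s nu ix.1 ix.2 - pair_prob s mu ix.1 ix.2| < d)].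
have : nbhs (mu : Prob X R) V.
  pose FF := nbhs_filter (mu : Prob X R).
  apply: (@filterI _ _ FF); apply: (@filter_forall _ _ _ _ FF) => k.
    exact: (near_weakstar mu (@determined_cyl G A D k) d0).
  exact: (near_weakstar mu (@determined_pair_obs G r s A D k.1 [set k.2]) d0).
rewrite nbhsE => -[U [oU Umu] UP].
exists U; split => //.
have Oh nu : U nu -> config_entropy (window_prob (D := D) nu) (pair_prob s nu) <= F + e / 2.
  move=> /UP[nk nx]; rewrite -lerBlDl; apply: le_trans (ler_norm _) _.
  by apply: dP => // i x; exact: nx (i, x).
pose c0 : R := config_coef R {ffun D -> A} r.
have c00 : 0 <= c0 by exact: config_coef_ge0.
pose c1 : R := #|{: {ffun D -> A}}|%:R + #|{: 'I_r * ({ffun D -> A} * {ffun D -> A})}|%:R.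
have c10 : 0 <= c1 by rewrite addr_ge0.
(* The term with [c0] absorbs the Stirling error and [c1] the logarithm of the number of types; the
   other half of e pays for the continuity of the entropy. *)
have [n0 n0P] : exists n0, forall n, (n0 <= n)%N ->
    c0 + (c0 * 2 + c1) * ln n.+1%:R <= e / 2 * n%:R.
  by apply: log_sublinear; rewrite ?addr_ge0 ?mulr_ge0.
apply: (@limn_esup_le_near _ _ _ n0) => n n0n.
rewrite (expectation_microstates fs).
set E := _ / _.
have E0 : 0 <= E by rewrite divr_ge0 ?exprn_ge0.
have bound := card_microstate_pairs_le fs n Z Oh.
set B := _ * expR _ in bound.
have cardE : (#|{: {ffun {ffun D -> A} -> 'I_n.+2}
      * {ffun 'I_r * ({ffun D -> A} * {ffun D -> A}) -> 'I_n.+2}}|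
    = n.+2 ^ (#|{: {ffun D -> A}}| + #|{: 'I_r * ({ffun D -> A} * {ffun D -> A})}|))%N.
  by rewrite card_prod !card_ffun card_ord expnD.
have lnB : ln B = c1 * ln n.+2%:R
    + (n.+1%:R * (F + e / 2) + config_err R {ffun D -> A} r n.+1).
  rewrite /B cardE natrX lnM ?posrE ?exprn_gt0 ?expR_gt0// lnXn// expRK.
  by congr (_ + _); rewrite -[LHS]mulr_natl natrD.
have B0 : 0 < B by rewrite /B cardE mulr_gt0 ?expR_gt0// ltr0n expn_gt0.
(* E may be 0, so its logarithm is compared in the extended reals. *)
have : (lne E%:E <= (ln B)%:E)%E.
  by rewrite -lne_EFin// lee_lne ?in_itv/= ?lee_fin ?leey ?andbT ?E0 ?(ltW B0).
move=> /(@lee_wpmul2l _ (n.+1%:R^-1)%:E); rewrite lee_fin invr_ge0 => /(_ (ler0n _ _)).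
move=> /le_trans; apply; rewrite -EFinM lee_fin lnB mulrC ler_pdivrMr//.
have := n0P n.+1 (leqW n0n); rewrite /config_err -/c0 /stirling_err.
set L := ln _ => H; apply: (@le_trans _ _
  (n.+1%:R * (F + e / 2) + (c0 + (c0 * 2 + c1) * L))).
  by rewrite le_eqVlt; apply/orP; left; apply/eqP; ring.
apply: (@le_trans _ _ (n.+1%:R * (F + e / 2) + e / 2 * n.+1%:R)); first by rewrite lerD2l.
by rewrite le_eqVlt; apply/orP; left; apply/eqP; field.
Qed.

Lemma pair_prob_support Z mu (D : {fset G}) i (kl : {ffun D -> A} * {ffun D -> A}) :
    closed Z -> mu Z = 1%E -> pair_prob s mu i kl != 0 ->
  exists2 z, Z z & pair_obs s D i z = kl.
Proof.
move=> cZ muZ; apply: contra_neqP => nz.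
have mC : measurable (~` Z : set (borel X)).
  by apply: sub_sigma_algebra; exact: closed_openC.
have mZ : measurable (Z : set (borel X)) by rewrite -(setCK Z); exact: measurableC.
have muC : mu (~` Z) = 0%E.
  by rewrite (probability_setC mu mZ) -[LHS]/(1 - mu Z)%E muZ subee.
suff : mu (pair_obs s D i @^-1` [set kl]) = 0%E by rewrite /pair_prob => ->.
apply: (subset_measure0 _ mC _ muC); first exact: measurable_pair_obs.
by move=> z zkl Zz; apply: nz; exists z.
Qed.

(** The support condition makes every pair of neighboring patterns occur in Z, so y is consistent
    and comes from some x. Summed closeness on patterns controls every set determined by the ball at
    once, which puts the empirical measure in O. Each name agrees on the ball with a point of Z, so
    it shows no forbidden pattern. *)
Lemma configuration_microstate Z mu rho n1 m O
    (c : {ffun 'I_r -> {perm 'I_m.+1}} * {ffun 'I_m.+1 -> {ffun Defs.ball s rho -> A}}) :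
    (0 < r)%N -> closed Z -> mu Z = 1%E -> (n1 <= rho)%N ->
    window_ball (Defs.ball s) mu n1 `<=` O ->
    (exists2 Wp : seq {fmap G -> A},
        (forall w g, w \in Wp -> g \in domf w -> g \in Defs.ball s rho)
      & Z = [set x | forall g w, w \in Wp ->
                   [fmap h : domf w => Defs.shift g x (val h) : A] <> w]) ->
    \sum_k `|(occ c.2 k)%:R / m.+1%:R - window_prob mu k| < n1.+1%:R^-1 ->
    (forall i kl, pair_prob s mu i kl = 0 ->
       occ (joint c.2 (fperm c.2 (c.1 i))) kl = 0%N) ->
  exists2 x, x \in microstates_in Z (sym_hom fs c.1) O & names fs rho c.1 x = c.2.
Proof.
case: c => t y /= r0 cZ muZ n1rho n1O [Wp WpD ZE] close supp.
have cons i v : exists2 z, Z z & pair_obs s (Defs.ball s rho) i z = (y v, y (t i v)).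
  apply: (pair_prob_support cZ muZ); apply/negP => /eqP /supp /eqP.
  rewrite -leqn0 leqNgt => /negP; apply; apply/card_gt0P; exists v.
  by rewrite inE !ffunE.
have [|x xy] := @names_of_consistent _ _ _ _ fs _ _ t y.
  by move=> i v; have [z _ zE] := cons i v; exists z.
exists x => //; rewrite inE; apply/andP; split.
  rewrite inE; apply/asboolP/n1O => C Cn1.
  have CD : determined (Defs.ball s rho) C.
    by apply: determinedS Cn1 => g; exact: ball_le.
  apply: le_lt_trans close.
  rewrite (fine_determined mu CD).
  rewrite (fine_determined (@empirical_prob R G A m (sym_hom fs t) x) CD) -sumrB.
  apply: (le_trans (ler_norm_sum _ _ _)).
  rewrite [leRHS](bigID (fun k => `[< C (extend k) >])) /=.
  rewrite -[leLHS]addr0; apply: lerD; last by rewrite sumr_ge0.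
  by apply: ler_sum => k _; rewrite window_prob_empirical xy.
(* A shift of a name is the name at another vertex v', so only windows at the identity have to be
   inspected. *)
apply/asboolP; have nameZ v : Z (name fs t x v).
  rewrite ZE => g w wW; rewrite -(invgK g) shift_name.
  set v' := perm_hom _ _ _ _ => wE.
  (* As r > 0, there is a generator, and the pattern at v' is the first half of a pair occurring in
     Z. *)
  have [z] := cons (Ordinal r0) v'; rewrite {1}ZE => /(_ 1%g w wW) zw [zy _]; apply: zw.
  apply: etrans wE; congr FinMap; apply/ffunP => h; rewrite !ffunE /Defs.shift invg1 mul1g.
  have /translates_agree : translates (@coord1 G A) (Defs.ball s rho) z
      = translates (@coord1 G A) (Defs.ball s rho) (name fs t x v').
    by rewrite zy -xy ffunE.
  by apply; apply: (WpD w) => //; exact: (valP h).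
rewrite /empirical (eq_bigr (fun=> 1%E)); last first.
  by move=> v _; rewrite diracE mem_set//; exact: nameZ.
by rewrite sumEFin sumr_const card_ord -EFinM mulVf.
Qed.

Lemma growth_rate_ge Z mu (O : set (Prob X R)) : (0 < r)%N -> subshift Z -> finite_type Z ->
    shift_invariant mu -> mu Z = 1%E -> open O -> O mu ->
  exists rho, ((F_functional s mu (translates (@coord1 G A) (Defs.ball s rho)))%:E
    <= growth_rate_in Z O)%E.
Proof.
move=> r0 [cZ _] [Wp ZE] inv muZ oO Omu.
have [rho0 h0] := free_basis_ball (\bigcup_(w <- Wp) domf w)%fset fs.
have [n1 n1O] : exists n1, window_ball (Defs.ball s) mu n1 `<=` O.
  apply: (weakstar_window _ _ oO Omu) => [m n mn|D].
    by apply/fsubsetP => g; exact: ball_le.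
  by have [rho rhoP] := free_basis_ball D fs; exists rho; apply/fsubsetP.
(* The ball contains both the forbidden windows and the window that controls O. *)
pose rho := maxn rho0 n1; exists rho; set D := Defs.ball s rho.
have WpD w g : w \in Wp -> g \in domf w -> g \in D.
  move=> wW gw; apply: (ball_le (leq_maxl _ _)); apply: h0.
  by apply/bigfcupP; exists w; rewrite ?wW.
rewrite F_functionalE; apply/lee_addgt0Pr => e e0; rewrite -leeBlDr//.
set p := window_prob mu; set q := pair_prob s mu; set F := config_entropy p q.
have e20 : 0 < e / 2 by rewrite divr_gt0.
have [d d0 dP] := config_entropy_continuous p q e20.
pose c0 : R := config_coef R {ffun D -> A} r.
have c00 : 0 <= c0 by exact: config_coef_ge0.
have [n2 n2P] : exists n2, forall n, (n2 <= n)%N -> c0 + (c0 * 2) * ln n.+1%:R <= e / 2 * n%:R.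
  by apply: log_sublinear; rewrite ?mulr_ge0.
apply: limn_esup_ge_frequently => m0.
(* The four terms make the index at least [m0], the Stirling error at most half of e per vertex, 1/n
   smaller than d, and |K|/n smaller than 1/(n1 + 1). *)
pose n3 := maxn (maxn m0 n2) (maxn (Num.truncn d^-1) (#|{: {ffun D -> A}}| * n1.+1)%N).
have [n n3n [N [W [sumN Wl Wr [Np Wq supp]]]]] := round_joint_types
  (@window_prob_ge0 _ _ _ D mu) (@pair_prob_ge0 _ _ _ s _ D mu) (sum_window_prob D mu)
  (@sum_pair_prob_l _ _ _ s _ D mu) (fun i l => @sum_pair_prob_r _ _ _ s _ D mu i l inv)
  ltr01 (ltn0Sn n3).
(* The types live on m + 1 vertices, which is the term of index m. *)
case: n n3n sumN Np Wq => [//|m n3m sumN Np Wq]; rewrite ltnS in n3m.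
exists m.
  by apply: leq_trans n3m; rewrite /n3 !leq_max leqnn.
have n2m : (n2 <= m.+1)%N by apply/leqW/(leq_trans _ n3m); rewrite /n3 !leq_max leqnn orbT.
have m0' : (0 : R) < m.+1%:R by rewrite ltr0n.
have rat (u : R) (v : nat) : `|m.+1%:R * u - v%:R| < 1 -> `|v%:R / m.+1%:R - u| < m.+1%:R^-1.
  move=> uv; rewrite -(ltr_pM2l m0') mulfV ?gt_eqF// -{1}(ger0_norm (ltW m0')) -normrM.
  by rewrite mulrBr mulrCA mulfV ?gt_eqF// mulr1 distrC.
have dm : m.+1%:R^-1 < d.
  rewrite invf_plt ?posrE//; apply: (lt_le_trans (truncnS_gt _)).
  by rewrite ler_nat ltnS; apply: leq_trans n3m; rewrite /n3 !leq_max leqnn !orbT.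
have Fle : F - e / 2 <= config_entropy (fun k => (N k)%:R / m.+1%:R)
    (fun i x => (W i x)%:R / m.+1%:R).
  rewrite lerBlDr -lerBlDl; apply: le_trans (ler_norm _) _; rewrite distrC.
  by apply: dP => [k|i x]; apply: lt_trans dm; apply: rat; [exact: Np|exact: Wq].
rewrite (expectation_microstates fs).
(* Every configuration of the chosen type is the image under [nm] of a microstate pair; this single
   type already gives the lower bound. *)
have sub : (#|configurations m.+1 N W| <= #|microstate_pairs fs Z O m|)%N.
  pose nm (tx : {ffun 'I_r -> {perm 'I_m.+1}} * {ffun 'I_m.+1 -> A}) :=
    (tx.1, names fs rho tx.1 tx.2).
  apply: leq_trans (leq_imset_card nm (mem (microstate_pairs fs Z O m))).
  apply/subset_leq_card/fintype.subsetP => c; rewrite inE => /andP[/forallP cN /forallP cW].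
  have [|||x xM xc] := @configuration_microstate Z mu rho n1 m O c
    r0 cZ muZ (leq_maxr _ _) n1O.
  - by exists Wp.
  - apply: (@le_lt_trans _ _ (#|{: {ffun D -> A}}|%:R / m.+1%:R)).
      rewrite mulr_natl -sumr_const; apply: ler_sum => k _.
      by rewrite (eqP (cN k)); apply/ltW/rat/Np.
    rewrite ltr_pdivrMr// mulrC ltr_pdivlMr// -natrM ltr_nat ltnS.
    by apply: leq_trans n3m; rewrite /n3 !leq_max leqnn !orbT.
  - move=> i kl /supp W0; apply/eqP; rewrite -W0; exact: (forallP (cW i) kl).
  apply/imsetP; exists (c.1, x); first by rewrite inE.
  by rewrite /nm /= xc -surjective_pairing.
have ge := card_configurations_ge R (ltn0Sn m) sumN Wl Wr.
set B := expR _ in ge; set E := _ / _.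
have BE : B <= E.
  by apply: (le_trans ge); rewrite ler_wpM2r ?invr_ge0 ?exprn_ge0// ler_nat.
have B0 : 0 < B by exact: expR_gt0.
have : ((ln B)%:E <= lne E%:E)%E.
  rewrite -lne_EFin// lee_lne ?in_itv/= ?lee_fin ?leey ?andbT ?(ltW B0)//.
  exact: le_trans (ltW B0) BE.
move=> /(@lee_wpmul2l _ (m.+1%:R^-1)%:E); rewrite lee_fin invr_ge0 => /(_ (ler0n _ _)).
apply: le_trans; rewrite -EFinM -EFinB lee_fin expRK mulrC ler_pdivlMr//.
have := n2P m.+1 n2m; rewrite /config_err -/c0 /stirling_err.
set L := ln _ => H.
move: Fle; set F' := config_entropy _ _ => Fle.
have : m.+1%:R * (F - e / 2) <= m.+1%:R * F' by rewrite ler_wpM2l.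
move: H; move: (m.+1%:R : R) (c0) (F) (F') (L) => M c G0 G' L'; lra.
Qed.

End growth.

Theorem theorem2p1 (R : realType) (G : groupType) (r : nat) (s : 'I_r -> G)
    (A : alphabetType) (Z : set (fullshift G A))
    (mu : probability (borel (fullshift G A)) R) :
  (0 < r)%N ->
  free_basis s ->
  subshift Z ->
  finite_type Z ->
  shift_invariant mu ->
  mu Z = 1%E ->
  f_invariant s mu = f_invariant_in Z mu.
Proof.
move=> r0 fs sZ fZ inv muZ; apply/eqP; rewrite eq_le; apply/andP; split.
  (* Each neighborhood of mu has a radius at which F is at most its growth rate. *)
  apply: le_ereal_inf_tmp => _ [U [oU Umu] <-].
  have [rho le_rho] := growth_rate_ge fs r0 sZ fZ inv muZ oU Umu.
  by apply: le_trans le_rho; apply: ereal_inf_lbound; exists rho.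
(* Conversely, each radius and each e > 0 have a neighborhood whose growth rate is at most F + e. *)
apply: le_ereal_inf_tmp => _ [rho _ <-]; apply/lee_addgt0Pr => e e0.
have [U [oU Umu Ule]] := growth_rate_le fs Z mu rho e0.
rewrite F_functionalE -EFinD; apply: le_trans Ule.
by apply: ereal_inf_lbound; exists U.
Qed.
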